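(* Let $K\subset\mathbb{R}^2$ be the Lévy Dragon, let $C$ be the $734\times734$ nonnegative integer matrix indexed by the set $S_e$ of neighborhood types (defined in the context), and let $\lambda$ be the spectral radius of $C$. Then $$\dim_H\partial K=\frac{\ln\lambda}{\ln\sqrt2}.$$
   Context: The Lévy Dragon: $f_1(x,y)=\left(\frac{x-y}{2},\frac{x+y}{2}\right)$, $f_2(x,y)=\left(\frac{x+y+1}{2},\frac{y-x+1}{2}\right)$, and $K$ is the unique nonempty compact subset of $\mathbb{R}^2$ with $K=f_1(K)\cup f_2(K)$. $\dim_H$ is Hausdorff dimension and $\partial K$ the topological boundary. Types: a (neighborhood) type is a binary vector $x=(x_1,\dots,x_{15})\in\{0,1\}^{15}$, encoded by the integer $\sum_{i=1}^{15}x_i2^{i-1}\in\{0,\dots,32767\}$. Each type $x$ has two children, the types $$c_1(x)=(x_8,x_1,x_9,x_8,x_{10},x_9,x_1,x_{10},x_{15},x_3,x_2,x_5,x_4,x_7,x_6),$$ $$c_2(x)=(x_{10},x_1,x_{12},x_{11},x_{14},x_{13},x_2,x_{15},x_3,x_8,x_1,x_9,x_8,x_{10},x_9).$$ Let $S_0=\{2^j: 0\le j\le 14\}$ (as codes of types) and $S_{k+1}=\{c_1(x),c_2(x): x\in S_k\}$. One has $S_{19}=S_{20}$, hence $S_{k}=S_{19}$ for all $k\ge 19$; put $S_\infty=S_{19}$, a set of $752$ types. Let $S_a=\{0,32767\}$, $$S_t=\{4,8,9,16,32,64,66,128,512,1024,1026,2048,4096,8192,8193,16384\},$$ and $S_e=S_\infty\setminus(S_a\cup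 S_t)$, a set of $734$ types. The matrix $C$ is indexed by $S_e\times S_e$, and its entry $C_{s,s'}$ is the number of $j\in\{1,2\}$ with $c_j(s)=s'$. (Geometric meaning, not needed for the statement: the types record which of the 15 triangles in the star of a triangle $T$ of the $k$-th triangulation of the plane belong to the $k$-th approximation of $K$, and $c_1,c_2$ give the types of the two halves of $T$ in the next triangulation.) *)

(* Defs.v *)
From Stdlib Require Import BinNatDef.
From HB Require Import structures.
From mathcomp Require Import all_boot all_order all_algebra.
From mathcomp Require Import all_classical all_reals all_analysis.
From mathcomp.real_closed Require Import complex.
Import Order.TTheory GRing.Theory Num.Theory.
Import numFieldNormedType.Exports.

Set Implicit Arguments.
Unset Strict Implicit.
Unset Printing Implicit Defensive.

Local Open Scope classical_set_scope.
Local Open Scope ring_scope.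

Section HausdorffDimension.
Context {R : realType} {T : Type} (dist : T -> T -> R).
Local Open Scope ereal_scope.

(* The diameter of the empty set is -oo. *)
Definition diam (U : set T) : \bar R :=
  ereal_sup [set (dist p.1 p.2)%:E | p in U `*` U].

(* Since 0 `^ 0 = 1, a nonempty set weighs 1 when s = 0. *)
Definition weight (s : R) (U : set T) : \bar R :=
  if U == set0 then 0 else poweR (diam U) s.

Definition delta_cover (delta : R) (A : set T) : set (nat -> set T) :=
  [set U | A `<=` \bigcup_i U i /\ forall i, diam (U i) <= delta%:E].

Definition hausdorff_premeasure (s delta : R) (A : set T) : \bar R :=
  ereal_inf [set \sum_(0 <= i <oo) weight s (U i) | U in delta_cover delta A].

Definition hausdorff_measure (s : R) (A : set T) : \bar R :=
  ereal_sup [set hausdorff_premeasure s delta A | delta in [set d : R | (0 < d)%R]].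

Definition hausdorff_dim (A : set T) : \bar R :=
  ereal_inf [set s%:E | s in [set s : R | (0 <= s)%R /\
                                          hausdorff_measure s A = 0]].

End HausdorffDimension.

Definition boundary {T : topologicalType} (A : set T) : set T :=
  closure A `\` A°.

(* The library norm on R * R is the sup norm. *)
Definition euclidean_dist {R : realType} (p q : R * R) : R :=
  Num.sqrt ((p.1 - q.1) ^+ 2 + (p.2 - q.2) ^+ 2).

Definition levy_f1 {R : realType} (p : R * R) : R * R :=
  ((p.1 - p.2) / 2, (p.1 + p.2) / 2).

Definition levy_f2 {R : realType} (p : R * R) : R * R :=
  ((p.1 + p.2 + 1) / 2, (p.2 - p.1 + 1) / 2).

Definition is_levy_dragon {R : realType} (K : set (R * R)) : Prop :=
  [/\ K !=set0, compact K & K = levy_f1 @` K `|` levy_f2 @` K].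

Definition nbtype := 15.-tuple bool.

(* Coordinates are numbered from 1 to 15. *)
Definition bit (x : nbtype) (i : nat) : bool := nth false x i.-1.

Definition type_code (x : nbtype) : nat :=
  (\sum_(1 <= i < 16) bit x i * 2 ^ i.-1)%N.

Definition child1 (x : nbtype) : nbtype :=
  map_tuple (bit x)
    [tuple 8; 1; 9; 8; 10; 9; 1; 10; 15; 3; 2; 5; 4; 7; 6]%N.

Definition child2 (x : nbtype) : nbtype :=
  map_tuple (bit x)
    [tuple 10; 1; 12; 11; 14; 13; 2; 15; 3; 8; 1; 9; 8; 10; 9]%N.

(* Codes are written in binary, to avoid large unary literals. *)
Definition types_of_codes (cs : seq BinNums.N) : {set nbtype} :=
  [set x | type_code x \in map nat_of_bin cs]%SET.

Fixpoint types_at (k : nat) : {set nbtype} :=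
  if k is k'.+1 then (child1 @: types_at k' :|: child2 @: types_at k')%SET
  else [set x | type_code x \in [seq (2 ^ j)%N | j <- iota 0 15]]%SET.

Definition Sinf : {set nbtype} := types_at 19.

Definition Sa : {set nbtype} := types_of_codes [:: 0; 32767]%num.

Definition St : {set nbtype} :=
  types_of_codes [:: 4; 8; 9; 16; 32; 64; 66; 128; 512; 1024; 1026; 2048;
                     4096; 8192; 8193; 16384]%num.

Definition Se : {set nbtype} := (Sinf :\: (Sa :|: St))%SET.

Definition child_matrix : 'M[nat]_#|Se| :=
  \matrix_(i, j) ((child1 (enum_val i) == enum_val j)
                  + (child2 (enum_val i) == enum_val j))%N.

Definition spectral_radius {R : realType} (n : nat) (A : 'M[R[i]]_n) : R :=
  sup [set ComplexField.Normc.normc z | z in [set z | eigenvalue A z]].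

(* Main.v *)
Require Import Defs.
From Stdlib Require Import BinNatDef.
From HB Require Import structures.
From mathcomp Require Import all_boot all_order all_algebra.
From mathcomp Require Import all_classical all_reals all_analysis.
From mathcomp Require Import zify ring lra.
From mathcomp.real_closed Require Import complex.
Import Order.TTheory GRing.Theory Num.Theory.
Import numFieldNormedType.Exports.

Set Implicit Arguments.
Unset Strict Implicit.
Unset Printing Implicit Defensive.

Local Open Scope classical_set_scope.
Local Open Scope ring_scope.

(** The triangles of the k-th triangulation are the images of one right
    isosceles triangle T under the maps z |-> (1 - i)^-k (u z + b), with u a
    unit and b an element of Z[i]; k-th approximations of K are unions of such
    triangles, and the type of a triangle records which of its 15 neighbours
    (itself included) belong to the approximation.  A triangle of type 0 is not
    contained in K, a triangle of full type is, and every boundary point of K is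
    close to a triangle of each level whose type is neither.

    Upper bound: by Cayley-Hamilton the number of such triangles of level k is
    O(mu^k) for every mu > lambda; the exceptional types S_t only form chains, so
    they do not increase the growth rate.  Their diameter is 2^(-k/2).

    Lower bound: if w is an eigenvector of C for the eigenvalue z, then v = |w|
    satisfies C v >= |z| v, so v(type) / |z|^k is a mass that does not decrease
    under subdivision.  Given a cover of the boundary of small total weight,
    one descends along triangles whose mass exceeds the mass of their
    subtriangles of the appropriate levels met by the cover.  All types on the
    way lie in S_e, and each type of S_e has a descendant of type 0; so the limit
    point is a boundary point, and it is not covered. *)

(** * The graph of types *)

Section TypeComputation.
Local Open Scope nat_scope.

Definition zero_type : nbtype := [tuple of nseq 15 false].
Definition full_type : nbtype := [tuple of nseq 15 true].

Definition child (j : bool) : nbtype -> nbtype := if j then child2 else child1.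

Fixpoint seq_code (s : seq bool) : BinNums.N :=
  if s is b :: s' then
    (if b then N.succ_double (seq_code s') else N.double (seq_code s'))
  else N0.

Fixpoint seq_decode (n : nat) (c : BinNums.N) : seq bool :=
  if n is n'.+1 then N.odd c :: seq_decode n' (N.div2 c) else [::].

Lemma seq_codeK s : seq_decode (size s) (seq_code s) = s.
Proof.
elim: s => //= b s IHs.
have -> : N.div2 (if b then N.succ_double (seq_code s)
                 else N.double (seq_code s)) = seq_code s.
  by case: b; case: (seq_code s).
by rewrite IHs; case: b; case: (seq_code s).
Qed.

Lemma nat_of_bin_double c : nat_of_bin (N.double c) = (nat_of_bin c).*2.
Proof. by case: c => //= p; rewrite NatTrec.doubleE. Qed.

Lemma nat_of_bin_succ_double c :
  nat_of_bin (N.succ_double c) = (nat_of_bin c).*2.+1.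
Proof. by case: c => //= p; rewrite NatTrec.doubleE. Qed.

Lemma seq_codeE s :
  \sum_(1 <= i < (size s).+1) nth false s i.-1 * 2 ^ i.-1
  = nat_of_bin (seq_code s).
Proof.
rewrite big_add1 /=.
elim: s => [|b s IHs] /=; first by rewrite big_geq.
rewrite big_nat_recl //= expn0 muln1.
have -> : \sum_(0 <= i < size s) nth false s i * 2 ^ i.+1
          = (nat_of_bin (seq_code s)).*2.
  rewrite -IHs -muln2 big_distrl /=; apply: eq_bigr => i _.
  by rewrite expnSr mulnA.
by case: b; rewrite ?nat_of_bin_double ?nat_of_bin_succ_double.
Qed.

Lemma type_codeE (x : nbtype) : type_code x = nat_of_bin (seq_code x).
Proof. by rewrite -seq_codeE size_tuple. Qed.

Lemma mem_types_of_codes (cs : seq BinNums.N) (x : nbtype) :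
  (x \in types_of_codes cs) = (seq_code x \in cs).
Proof.
by rewrite inE type_codeE mem_map //; exact: can_inj nat_of_binK.
Qed.

Definition seq_child1 (s : seq bool) : seq bool :=
  map (fun i => nth false s i.-1) [:: 8; 1; 9; 8; 10; 9; 1; 10; 15; 3; 2; 5; 4; 7; 6].
Definition seq_child2 (s : seq bool) : seq bool :=
  map (fun i => nth false s i.-1) [:: 10; 1; 12; 11; 14; 13; 2; 15; 3; 8; 1; 9; 8; 10; 9].

Lemma val_child1 (x : nbtype) : val (child1 x) = seq_child1 x.
Proof. by []. Qed.

Lemma val_child2 (x : nbtype) : val (child2 x) = seq_child2 x.
Proof. by []. Qed.

(** The bit strings of the codes [2 ^ j], that is, the set S_0. *)
Definition singletons : seq (seq bool) :=
  [seq [seq i == j | i <- iota 0 15] | j <- iota 0 15].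

(* Finite sets of bit strings as binary tries: the closure computation below
   has to remain feasible for the kernel's conversion test. *)
Inductive trie := Tip | Node of bool & trie & trie.

Fixpoint trie_mem (s : seq bool) (t : trie) : bool :=
  match t, s with
  | Tip, _ => false
  | Node b _ _, [::] => b
  | Node _ l r, x :: s' => if x then trie_mem s' r else trie_mem s' l
  end.

Fixpoint trie_add (s : seq bool) (t : trie) : trie :=
  match s with
  | [::] => if t is Node _ l r then Node true l r else Node true Tip Tip
  | x :: s' =>
      match t with
      | Tip => if x then Node false Tip (trie_add s' Tip)
               else Node false (trie_add s' Tip) Tip
      | Node b l r => if x then Node b l (trie_add s' r)
                      else Node b (trie_add s' l) r
      end
  end.

Fixpoint trie_elements (t : trie) : seq (seq bool) :=
  if t is Node b l r then
    (if b then cons [::] else id)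
      (map (cons false) (trie_elements l) ++ map (cons true) (trie_elements r))
  else [::].

Lemma trie_mem_add s s' t : trie_mem s' (trie_add s t) = (s' == s) || trie_mem s' t.
Proof.
have mTip v : trie_mem v Tip = false by case: v.
elim: s s' t => [|x s IHs].
  by case=> [|y v]; case=> [|b l r] //=; rewrite !mTip if_same.
case=> [|y s']; case=> [|b l r] /=.
- by case: x.
- by case: x.
- by case: x y => [] [] /=; rewrite ?IHs ?eqseq_cons ?mTip ?orbF.
- by case: x y => [] [] /=; rewrite ?IHs ?eqseq_cons.
Qed.

Lemma mem_trie_elements s t : (s \in trie_elements t) = trie_mem s t.
Proof.
have inj b : injective (cons (b : bool)) by move=> ? ? [].
have disj (b c : bool) (L : seq (seq bool)) u :
    (b :: u \in map (cons c) L) = (b == c) && (u \in L).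
  have [<-|bc] := eqVneq b c; first by rewrite mem_map.
  by apply/mapP => -[v _ [/eqP]]; rewrite (negPf bc).
have nil c (L : seq (seq bool)) : ([::] \in map (cons c) L) = false.
  by apply/mapP => -[].
elim: t s => [|b l IHl r IHr] [|x s] //=.
  by case: b; rewrite ?inE // mem_cat !nil.
have -> : (x :: s \in (if b then cons [::] else id)
      (map (cons false) (trie_elements l) ++ map (cons true) (trie_elements r)))
    = (x :: s \in map (cons false) (trie_elements l)
                  ++ map (cons true) (trie_elements r)).
  by case: b.
by rewrite mem_cat !disj IHl IHr; case: x; rewrite /= ?orbF.
Qed.

Definition trie_of : seq (seq bool) -> trie := foldr trie_add Tip.

Lemma trie_mem_of s L : trie_mem s (trie_of L) = (s \in L).
Proof.
elim: L => [|t L IHL] /=; first by case: s.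
by rewrite trie_mem_add inE IHL.
Qed.

(** Passing through a trie removes repetitions, so the list does not double at each level; binding
    [L] by [fun] makes the recursive call evaluated only once. *)
Fixpoint seq_types_at (k : nat) : seq (seq bool) :=
  if k is k'.+1 then
    (fun L => trie_elements (trie_of (map seq_child1 L ++ map seq_child2 L)))
      (seq_types_at k')
  else singletons.

Lemma mem_seq_types_atS k s :
  (s \in seq_types_at k.+1) = (s \in map seq_child1 (seq_types_at k))
                              || (s \in map seq_child2 (seq_types_at k)).
Proof. by rewrite /= mem_trie_elements trie_mem_of mem_cat. Qed.

Lemma mem_types_at0 (x : nbtype) : (x \in types_at 0) = (val x \in singletons).
Proof.
have powE : [seq 2 ^ j | j <- iota 0 15]
    = map nat_of_bin (map seq_code singletons).
  rewrite /singletons -!map_comp; apply/eq_in_map => j; rewrite mem_iota add0n => /= jlt.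
  have sz : size [seq i == j | i <- iota 0 15] = 15 by [].
  transitivity (nat_of_bin (seq_code [seq i == j | i <- iota 0 15])) => //.
  rewrite -seq_codeE sz big_add1 big_mkord (bigD1 (Ordinal jlt)) //= big1.
    by rewrite -[nth _ _ _]/(nth false [seq i == j | i <- iota 0 15] j)
       (nth_map 0) ?size_iota // nth_iota // add0n eqxx addn0 mul1n.
  move=> i; rewrite -val_eqE /= => /negbTE ij.
  by rewrite -[nth _ _ _]/(nth false [seq i == j | i <- iota 0 15] i)
       (nth_map 0) ?size_iota // nth_iota // add0n ij.
rewrite /types_at inE powE type_codeE mem_map; last exact: can_inj nat_of_binK.
apply/idP/idP; last exact: map_f.
move=> /mapP[s sin e].
have sz : size s = 15 by move/mapP: sin => [j _ ->].
suff -> : val x = s by [].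
(* A string is recovered from its code and its length, and both strings have length 15. *)
by rewrite -(seq_codeK s) -e sz -[X in _ = seq_decode X _](size_tuple x) seq_codeK.
Qed.

Lemma size_singletons : all (fun s => size s == 15) singletons.
Proof. by []. Qed.

Lemma size_seq_types_at k s : s \in seq_types_at k -> size s = 15.
Proof.
case: k => [|k]; first by move/(allP size_singletons)/eqP.
by rewrite mem_seq_types_atS => /orP[] /mapP[t _ ->].
Qed.

Lemma mem_types_at k (x : nbtype) : (x \in types_at k) = (val x \in seq_types_at k).
Proof.
elim: k x => [|k IHk] x; first exact: mem_types_at0.
rewrite mem_seq_types_atS finset.in_setU; congr orb.
  apply/imsetP/mapP => [[y yk ->]|[s sk xs]]; first by exists (val y); rewrite -?IHk.
  exists (Tuple (introT eqP (size_seq_types_at sk))); first by rewrite IHk.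
  by apply: val_inj; rewrite val_child1.
apply/imsetP/mapP => [[y yk ->]|[s sk xs]]; first by exists (val y); rewrite -?IHk.
exists (Tuple (introT eqP (size_seq_types_at sk))); first by rewrite IHk.
by apply: val_inj; rewrite val_child2.
Qed.

Definition code_a : seq BinNums.N := [:: 0; 32767]%num.
Definition code_t : seq BinNums.N :=
  [:: 4; 8; 9; 16; 32; 64; 66; 128; 512; 1024; 1026; 2048;
      4096; 8192; 8193; 16384]%num.
Definition seq_exceptional (s : seq bool) : bool :=
  (seq_code s \notin code_a) && (seq_code s \notin code_t).

Lemma mem_Sa (x : nbtype) : (x \in Sa) = (seq_code x \in code_a).
Proof. exact: mem_types_of_codes. Qed.

Lemma mem_St (x : nbtype) : (x \in St) = (seq_code x \in code_t).
Proof. exact: mem_types_of_codes. Qed.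

Definition seq_absorbing (s : seq bool) : bool := seq_code s \in code_a.
Definition seq_transient (s : seq bool) : bool := seq_code s \in code_t.

(** One backward step in the graph of types. Iterated from the zero type, it collects only types
    having a descendant of type 0. *)
Definition reach_step (E : seq (seq bool)) (t : trie) : trie :=
  foldr (fun s u => if trie_mem (seq_child1 s) t then trie_add s u
                    else if trie_mem (seq_child2 s) t then trie_add s u else u)
    t E.

(** The finite facts behind both bounds. The first keeps all later types in [L]; the next two keep
    the children of S_e in S_e or S_a and let a line of descent inside S_e go on for ever; the
    fourth forbids branching inside S_t; the last one yields points outside K in every triangle
    whose type lies in S_e. *)
Definition check_types (L E : seq (seq bool)) (tL reach : trie) : bool :=
  [&& all (fun s => trie_mem (seq_child1 s) tL && trie_mem (seq_child2 s) tL) L,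
      all (fun s => (seq_exceptional (seq_child1 s) || seq_absorbing (seq_child1 s))
                 && (seq_exceptional (seq_child2 s) || seq_absorbing (seq_child2 s))) E,
      all (fun s => seq_exceptional (seq_child1 s) || seq_exceptional (seq_child2 s)) E,
      all (fun s => seq_transient s ==>
             ~~ (seq_transient (seq_child1 s) && seq_transient (seq_child2 s))) L,
      has seq_exceptional L
    & all (fun s => trie_mem s reach) E].

(* Arguments are bound by [fun] so that they are evaluated only once. *)
Definition check_all (n k : nat) : bool :=
  (fun L => (fun E =>
    check_types L E (trie_of L)
      (iter k (reach_step E) (trie_of [:: nseq 15 false])))
   [seq s <- L | seq_exceptional s]) (seq_types_at n).

(** Nineteen generations give [Sinf]; eighteen backward steps from type 0 are enough to find every
    type of S_e. *)
Lemma check_all19 : check_all 19 18.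
Proof. by vm_compute. Qed.

End TypeComputation.

(** * Descent in the graph of types *)

Section TypeGraph.
Local Open Scope nat_scope.

Lemma mem_SeE (x : nbtype) :
  (x \in Se) = [&& x \in Sinf, x \notin Sa & x \notin St].
Proof. by rewrite finset.in_setD finset.in_setU negb_or andbC. Qed.

Definition exceptionals (L : seq (seq bool)) := [seq s <- L | seq_exceptional s].

Lemma check_allE n k :
  check_all n k =
  check_types (seq_types_at n) (exceptionals (seq_types_at n))
    (trie_of (seq_types_at n))
    (iter k (reach_step (exceptionals (seq_types_at n))) (trie_of [:: nseq 15 false])).
Proof. by []. Qed.

(** The list is hidden behind an existential, so that later proofs use the check without unfolding
    the computed list. *)
Lemma check_typesP : exists L : seq (seq bool),
  [/\ forall x : nbtype, (x \in Sinf) = (val x \in L),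
      forall s, s \in L -> size s = 15
    & check_types L (exceptionals L) (trie_of L)
        (iter 18 (reach_step (exceptionals L)) (trie_of [:: nseq 15 false]))].
Proof.
exists (seq_types_at 19); split; first exact: mem_types_at.
  exact: size_seq_types_at.
by have := check_all19; rewrite check_allE.
Qed.

Lemma Sinf_types_at : Sinf = types_at 19.
Proof. reflexivity. Qed.

Local Opaque Sinf Se.

Lemma val_child j (x : nbtype) :
  val (child j x) = if j then seq_child2 x else seq_child1 x.
Proof. by case: j. Qed.

Lemma child_Sinf j (x : nbtype) : x \in Sinf -> child j x \in Sinf.
Proof.
have [L [SinfL _ /and5P[/allP chk _ _ _ _]]] := check_typesP.
rewrite !SinfL val_child => /chk.
by rewrite !trie_mem_of => /andP[]; case: j.
Qed.

Lemma Se_sub_Sinf (x : nbtype) : x \in Se -> x \in Sinf.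
Proof. by rewrite mem_SeE => /andP[]. Qed.

Lemma seq_exceptionalE (x : nbtype) :
  seq_exceptional x = (x \notin Sa) && (x \notin St).
Proof. by rewrite mem_Sa mem_St. Qed.

Lemma mem_exceptionals (L : seq (seq bool)) (x : nbtype) :
  (forall y : nbtype, (y \in Sinf) = (val y \in L)) ->
  (val x \in exceptionals L) = (x \in Se).
Proof. by move=> SinfL; rewrite mem_filter seq_exceptionalE mem_SeE SinfL andbC. Qed.

Lemma child_Se j (x : nbtype) :
  x \in Se -> (child j x \in Se) || (child j x \in Sa).
Proof.
move=> xSe; have := child_Sinf j (Se_sub_Sinf xSe).
rewrite mem_SeE => ->.
have [L [SinfL _ /and3P[_ /allP chk _]]] := check_typesP.
have := chk x; rewrite mem_exceptionals // => /(_ xSe).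
rewrite -val_child1 -val_child2 !seq_exceptionalE.
by rewrite /seq_absorbing -!mem_Sa => /andP[]; case: j.
Qed.

Lemma Se_has_child (x : nbtype) : x \in Se -> exists j, child j x \in Se.
Proof.
move=> xSe; have xS j := child_Sinf j (Se_sub_Sinf xSe).
have [L [SinfL _ /and4P[_ _ /allP chk _]]] := check_typesP.
have := chk x; rewrite mem_exceptionals // => /(_ xSe).
rewrite -val_child1 -val_child2 !seq_exceptionalE => /orP[] h.
  by exists false; rewrite mem_SeE xS.
by exists true; rewrite mem_SeE xS.
Qed.

(** Descendants inside S_t thus form a single chain, with side branches that have left S_t; this
    prevents exponential growth within S_t. *)
Lemma St_child (x : nbtype) : x \in Sinf -> x \in St ->
  (child1 x \notin St) || (child2 x \notin St).
Proof.
have [L [SinfL _ /and5P[_ _ _ /allP chk _]]] := check_typesP.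
rewrite SinfL => xL xt; have /implyP := chk _ xL.
rewrite /seq_transient -mem_St => /(_ xt).
by rewrite -val_child1 -val_child2 -!mem_St negb_and.
Qed.

Lemma Se_neq0 : exists x : nbtype, x \in Se.
Proof.
have [L [SinfL szL /and5P[_ _ _ _ /andP[/hasP[s sL se] _]]]] := check_typesP.
exists (Tuple (introT eqP (szL _ sL))).
by rewrite -(mem_exceptionals _ SinfL) mem_filter sL se.
Qed.

Definition descend : nbtype -> seq bool -> nbtype := foldl (fun x j => child j x).

Lemma reach_step_cons u E t :
  reach_step (u :: E) t =
  if trie_mem (seq_child1 u) t then trie_add u (reach_step E t)
  else if trie_mem (seq_child2 u) t then trie_add u (reach_step E t)
  else reach_step E t.
Proof. by []. Qed.

Local Opaque trie_mem reach_step seq_child1 seq_child2.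

Lemma reach_step_ind (P : seq bool -> Prop) (t : trie) (E : seq (seq bool)) :
  (forall s, P (seq_child1 s) \/ P (seq_child2 s) -> P s) ->
  (forall s, trie_mem s t -> P s) ->
  forall s, trie_mem s (reach_step E t) -> P s.
Proof.
move=> stepP tP; elim: E => [|u E IHE] s; first exact: tP.
rewrite reach_step_cons.
have addP : P u -> trie_mem s (trie_add u (reach_step E t)) -> P s.
  by move=> Pu; rewrite trie_mem_add => /orP[/eqP->|/IHE].
case: ifP => [e1|_]; first by apply/addP/stepP; left; apply: tP.
case: ifP => [e2|_]; last exact: IHE.
by apply/addP/stepP; right; apply: tP.
Qed.

Lemma Se_reach0 (x : nbtype) : x \in Se -> exists w, descend x w = zero_type.
Proof.
have [L [SinfL _ /and5P[_ _ _ _ /andP[_ /allP chk]]]] := check_typesP.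
rewrite -(mem_exceptionals _ SinfL) => xE; move: (exceptionals L) xE chk => E xE chk.
(* Having type 0 as a descendant is inherited by parents, so it propagates through each backward
   step. *)
pose good s := exists w, foldl (fun s j => if j then seq_child2 s else seq_child1 s)
                               s w = nseq 15 false.
have good0 s : trie_mem s (trie_of [:: nseq 15 false]) -> good s.
  by rewrite trie_mem_of inE => /eqP->; exists [::].
have goodS t : (forall s, trie_mem s t -> good s) ->
    forall s, trie_mem s (reach_step E t) -> good s.
  move=> ht; apply: reach_step_ind ht => s [] [w ws]; first by exists (false :: w).
  by exists (true :: w).
have goodn n s : trie_mem s (iter n (reach_step E) (trie_of [:: nseq 15 false])) ->
    good s.
  by elim: n s => [|n IHn]; [exact: good0 | exact: goodS].
have [w] := goodn _ _ (chk _ xE).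
have -> : foldl (fun s j => if j then seq_child2 s else seq_child1 s) x w
          = val (descend x w).
  by elim: w (x) => // j w IHw y; rewrite [RHS]/= -IHw /= -val_child.
by move=> e; exists w; apply: val_inj.
Qed.

Lemma SaP (x : nbtype) : reflect (x = zero_type \/ x = full_type) (x \in Sa).
Proof.
have decode y : seq_code x = y -> val x = seq_decode 15 y.
  by move=> <-; rewrite -[LHS]seq_codeK size_tuple.
rewrite mem_Sa; apply: (iffP idP) => [|[->|->] //].
rewrite !inE => /orP[] /eqP/decode e; [left | right]; exact: val_inj.
Qed.

Lemma Sinf_cases (x : nbtype) : x \in Sinf -> [\/ x \in Se, x \in Sa | x \in St].
Proof.
rewrite mem_SeE => ->; case: (boolP (x \in Sa)) => xa; first by constructor 2.
case: (boolP (x \in St)) => xt; first by constructor 3.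
by constructor 1.
Qed.

Lemma child_zero j : child j zero_type = zero_type.
Proof. by apply: val_inj; case: j. Qed.

Lemma child_full j : child j full_type = full_type.
Proof. by apply: val_inj; case: j. Qed.

Lemma child_Sa j x : x \in Sa -> child j x \in Sa.
Proof.
by move=> /SaP[->|->]; rewrite ?child_zero ?child_full; apply/SaP; [left|right].
Qed.

Lemma types_at_child j k x : x \in types_at k -> child j x \in types_at k.+1.
Proof.
move=> xk; rewrite [types_at k.+1]/= finset.in_setU; apply/orP.
by case: j; [right | left]; apply/imsetP; exists x.
Qed.

End TypeGraph.

(** * Triangles as Gaussian affine maps *)

(* [((u1, u2), (b1, b2))] stands for the map [z |-> u z + b] of the complex
   plane, with [u = u1 + i u2] a unit and [b = b1 + i b2]; scaled down by
   [(1 - i) ^- k] it names a triangle of the [k]-th triangulation. *)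
Definition elem : Type := (int * int) * (int * int).

Definition unit_elem (p : elem) : bool :=
  p.1 \in [:: (1, 0); (0, 1); (-1, 0); (0, -1)].

Definition id_elem : elem := ((1, 0), (0, 0)).

Definition mul_elem (p q : elem) : elem :=
  let: ((u1, u2), (b1, b2)) := p in
  let: ((v1, v2), (c1, c2)) := q in
  ((u1 * v1 - u2 * v2, u1 * v2 + u2 * v1),
   (b1 + (u1 * c1 - u2 * c2), b2 + (u1 * c2 + u2 * c1))).

(** The inverse of a unit is its conjugate, so the inverse map sends [z] to
    [conj u * z - conj u * b]. *)
Definition inv_elem (p : elem) : elem :=
  let: ((u1, u2), (b1, b2)) := p in
  ((u1, - u2), (- (u1 * b1 + u2 * b2), - (u1 * b2 - u2 * b1))).

(* Composition on the right with the map sending [T] onto one of its halves. *)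
Definition half_elem (j : bool) (p : elem) : elem :=
  let: ((u1, u2), (b1, b2)) := p in
  if j then ((- u2, u1), (b1 + u1 + (b2 + u2), b2 + u2 - (b1 + u1)))
  else ((- u1, - u2), (b1 + b2 + u1, b2 - b1 + u2)).

(* Composition on the right with [levy_f1] ([j = false]) or [levy_f2]. *)
Definition copy_elem (j : bool) (p : elem) : elem :=
  let: ((u1, u2), (b1, b2)) := p in
  if j then ((u2, - u1), (b1 + b2 + u1, b2 - b1 + u2))
  else ((u1, u2), (b1 + b2, b2 - b1)).

(* The maps [h] such that [h T] meets [T], in the numbering of the types. *)
Definition star : 15.-tuple elem :=
  [tuple ((1, 0), (0, 0)); ((-1, 0), (1, 0)); ((0, -1), (0, 0));
         ((0, 1), (0, -1)); ((-1, 0), (0, 0)); ((1, 0), (-1, 0));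
         ((0, 1), (0, 0)); ((0, -1), (0, 1)); ((-1, 0), (1, 1));
         ((0, 1), (1, 0)); ((0, -1), (1, 1)); ((1, 0), (1, 0));
         ((-1, 0), (2, 0)); ((0, -1), (1, 0)); ((0, 1), (1, -1))].

(** The maps [lvl k p] with [p] in this list are the compositions of length [k] of [levy_f1] and
    [levy_f2]. *)
Fixpoint levy_approx (k : nat) : seq elem :=
  if k is k'.+1 then map (copy_elem false) (levy_approx k') ++ map (copy_elem true) (levy_approx k')
  else [:: id_elem].

Definition elem_type (k : nat) (p : elem) : nbtype :=
  map_tuple (fun h => mul_elem p h \in levy_approx k) star.

Definition refine (p : elem) (w : seq bool) : elem :=
  foldl (fun q j => half_elem j q) p w.

Lemma unit_elemP (p : elem) : unit_elem p ->
  [\/ p.1 = (1, 0), p.1 = (0, 1), p.1 = (-1, 0) | p.1 = (0, -1)].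
Proof.
rewrite /unit_elem !inE => /or4P[] /eqP ->.
- by constructor 1.
- by constructor 2.
- by constructor 3.
- by constructor 4.
Qed.

Lemma unit_half j p : unit_elem (half_elem j p) = unit_elem p.
Proof.
case: p j => [[u1 u2] [b1 b2]] []; rewrite /unit_elem /= !inE !xpair_eqE; lia.
Qed.

Lemma unit_copy j p : unit_elem (copy_elem j p) = unit_elem p.
Proof.
case: p j => [[u1 u2] [b1 b2]] []; rewrite /unit_elem /= !inE !xpair_eqE; lia.
Qed.

Lemma unit_mul p q : unit_elem p -> unit_elem q -> unit_elem (mul_elem p q).
Proof.
case: p q => [[u1 u2] [b1 b2]] [[v1 v2] [c1 c2]].
by move=> /unit_elemP[] /= [-> ->] /unit_elemP[] /= [-> ->].
Qed.

Lemma unit_inv p : unit_elem p -> unit_elem (inv_elem p).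
Proof. by case: p => [[u1 u2] [b1 b2]] /unit_elemP[] /= [-> ->]. Qed.

Lemma unit_star h : h \in (star : seq elem) -> unit_elem h.
Proof. by apply/allP: h. Qed.

Lemma unit_approx k p : p \in levy_approx k -> unit_elem p.
Proof.
elim: k p => [|k IHk] p /=; first by rewrite inE => /eqP->.
by rewrite mem_cat => /orP[] /mapP[q /IHk qu ->]; rewrite unit_copy.
Qed.

Lemma unit_refine p w : unit_elem (refine p w) = unit_elem p.
Proof. by elim: w p => //= j w IHw p; rewrite IHw unit_half. Qed.

Lemma mul_elemA p q r : mul_elem (mul_elem p q) r = mul_elem p (mul_elem q r).
Proof.
case: p q r => [[u1 u2] [b1 b2]] [[v1 v2] [c1 c2]] [[w1 w2] [d1 d2]] /=.
by congr ((_, _), (_, _)); ring.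
Qed.

Lemma mul_id p : mul_elem p id_elem = p.
Proof. by case: p => [[u1 u2] [b1 b2]] /=; congr ((_, _), (_, _)); ring. Qed.

Lemma id_mul p : mul_elem id_elem p = p.
Proof. by case: p => [[u1 u2] [b1 b2]] /=; congr ((_, _), (_, _)); ring. Qed.

Lemma mul_inv p : unit_elem p -> mul_elem p (inv_elem p) = id_elem.
Proof.
case: p => [[u1 u2] [b1 b2]] /unit_elemP[] /= [-> ->];
  by congr ((_, _), (_, _)); ring.
Qed.

Lemma star_inv h : h \in (star : seq elem) -> inv_elem h \in (star : seq elem).
Proof. by apply/allP: h. Qed.

Lemma half_inj j : injective (half_elem j).
Proof.
case: j => [] [[u1 u2] [b1 b2]] [[v1 v2] [c1 c2]] /= [? ? ? ?];
  by congr ((_, _), (_, _)); lia.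
Qed.

Lemma copy_inj j : injective (copy_elem j).
Proof.
case: j => [] [[u1 u2] [b1 b2]] [[v1 v2] [c1 c2]] /= [? ? ? ?];
  by congr ((_, _), (_, _)); lia.
Qed.

(** Parity of the sum of the two translation coordinates: it is odd for a first half, since
    [u1 + u2] is odd for a unit, and even for a second half. *)
Lemma half_neq p q : unit_elem p -> half_elem false p <> half_elem true q.
Proof.
case: p q => [[u1 u2] [b1 b2]] [[v1 v2] [c1 c2]].
by move=> /unit_elemP[] /= [-> ->] [] *; lia.
Qed.

(** The same parity argument, with the two parities exchanged. *)
Lemma copy_neq p q : unit_elem q -> copy_elem false p <> copy_elem true q.
Proof.
case: p q => [[u1 u2] [b1 b2]] [[v1 v2] [c1 c2]].
by move=> /unit_elemP[] /= [-> ->] [] *; lia.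
Qed.

Lemma half_surj p : unit_elem p -> exists j q, p = half_elem j q.
Proof.
case: p => [[u1 u2] [b1 b2]] up.
(* The parity tells which half [p] is; the witness then comes from solving the formulas of
   [half_elem] for the parent. *)
have [m [e|e]] : exists m : int, (b1 + b2 = m * 2 \/ b1 + b2 = m * 2 + 1).
- exists ((b1 + b2) %/ 2)%Z.
  by have := divz_eq (b1 + b2) 2; have := modz_ge0 (b1 + b2) (isT : (2 : int) != 0);
     have := ltz_pmod (b1 + b2) (isT : (0 < (2 : int))); lia.
- exists true, ((u2, - u1), (b1 - m - u2, m + u1)) => /=.
  by congr ((_, _), (_, _)); lia.
- move/unit_elemP: up => /= up.
  exists false, ((- u1, - u2), ((b1 + u1 - (b2 + u2)) %/ 2, (b1 + u1 + (b2 + u2)) %/ 2))%Z.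
  by case: up => -[-> ->] /=; congr ((_, _), (_, _)); lia.
Qed.

Lemma refine_surj k p : unit_elem p -> exists q w,
  [/\ unit_elem q, size w = k & p = refine q w].
Proof.
elim: k p => [|k IHk] p up; first by exists p, [::].
have [j [q pE]] := half_surj up; have uq : unit_elem q by rewrite -(unit_half j) -pE.
have [r [w [ur sw qE]]] := IHk q uq.
exists r, (rcons w j); split; rewrite ?size_rcons ?sw //.
by rewrite pE qE /refine -cats1 foldl_cat.
Qed.

Lemma mem_approxS k j p : unit_elem p ->
  (copy_elem j p \in levy_approx k.+1) = (p \in levy_approx k).
Proof.
move=> up; rewrite /= mem_cat; apply/idP/idP.
  case: j => /orP[] /mapP[q qk e].
  - by case: (@copy_neq q p).
  - by rewrite (copy_inj e).
  - by rewrite (copy_inj e).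
  - by case: (@copy_neq p q) => //; exact: unit_approx qk.
by move=> pk; apply/orP; case: j; [right | left]; apply: map_f.
Qed.

#[local] Arguments mul_elem : simpl never.
#[local] Arguments half_elem : simpl never.
#[local] Arguments levy_approx : simpl never.

(** This ties the combinatorial children to the geometry. Each neighbour [h] of a half is a copy,
    under one of the two dragon maps, of a neighbour [g] of [p]; it belongs to the approximation of
    level [k.+1] exactly when that neighbour of [p] belongs to the one of level [k]. The index of
    [g] in [star] is the entry in the tuple defining the child. *)
Lemma elem_type_half k j p : unit_elem p ->
  elem_type k.+1 (half_elem j p) = child j (elem_type k p).
Proof.
move=> up; apply: val_inj.
have key i h g : mul_elem (half_elem j p) h = copy_elem i (mul_elem p g) ->
    g \in (star : seq elem) ->
    (mul_elem (half_elem j p) h \in levy_approx k.+1) = (mul_elem p g \in levy_approx k).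
  by move=> -> gs; rewrite mem_approxS // unit_mul // unit_star.
move: key; rewrite /child; case: j; rewrite [RHS]/= /bit [RHS]/= => key;
  rewrite [LHS]/=.
all: congr [:: _; _; _; _; _; _; _; _; _; _; _; _; _; _; _].
all: first [apply: (key false) => //; solve [clear; case: p => [[u1 u2] [b1 b2]];
       rewrite /half_elem /copy_elem /mul_elem; congr ((_, _), (_, _)); lia]
     | apply: (key true) => //; clear; case: p => [[u1 u2] [b1 b2]];
       rewrite /half_elem /copy_elem /mul_elem; congr ((_, _), (_, _)); lia].
Qed.

Lemma elem_type_refine k p w : unit_elem p ->
  elem_type (size w + k) (refine p w) = descend (elem_type k p) w.
Proof.
elim: w k p => [|j w IHw] k p up //=.
by rewrite -elem_type_half // -IHw ?unit_half // addnS.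
Qed.

Lemma elem_type_neq0 k p : elem_type k p <> zero_type ->
  exists2 h, h \in (star : seq elem) & mul_elem p h \in levy_approx k.
Proof.
move=> ne; case: (boolP (has (fun h => mul_elem p h \in levy_approx k) star)).
  by move=> /hasP.
move=> /hasPn none; case: ne; apply: val_inj => /=.
rewrite -[LHS]/(map (fun h => mul_elem p h \in levy_approx k) star).
rewrite -[RHS]/(map (fun=> false) (star : seq elem)).
by apply/eq_in_map => h /none/negPf.
Qed.

Lemma elem_type_zero k p h : elem_type k p = zero_type ->
  h \in (star : seq elem) -> mul_elem p h \notin levy_approx k.
Proof.
move=> /(congr1 val) e hs; apply/negP => pk.
have : true \in val (elem_type k p) by apply/mapP; exists h.
by rewrite e.
Qed.

Lemma elem_type_full k p h : elem_type k p = full_type ->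
  h \in (star : seq elem) -> mul_elem p h \in levy_approx k.
Proof.
move=> /(congr1 val) e hs; apply/negPn/negP => /negPf pk.
have : false \in val (elem_type k p) by apply/mapP; exists h.
by rewrite e.
Qed.

(** The approximation of level 0 is T alone, so some neighbour of [p] is T, and [star] is closed
    under inverses. *)
Lemma elem_type0_neq0 p : unit_elem p -> elem_type 0 p <> zero_type ->
  p \in (star : seq elem).
Proof.
move=> up /elem_type_neq0[h hs]; rewrite inE => /eqP e.
suff -> : p = inv_elem h by exact: star_inv.
by rewrite -[p]mul_id -(mul_inv (unit_star hs)) -mul_elemA e id_mul.
Qed.

Lemma star_elem_type p : p \in (star : seq elem) -> elem_type 0 p \in types_at 0.
Proof. by rewrite mem_types_at0; apply/allP: p; vm_compute. Qed.

(** Every abstract type occurs at an actual triangle, which gives the lower bound a triangle to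
    start from. *)
Lemma types_at_elem_type k t : t \in types_at k ->
  exists p w, [/\ p \in (star : seq elem), size w = k
                & t = elem_type k (refine p w)].
Proof.
elim: k t => [|k IHk] t.
  rewrite mem_types_at0 => ts.
  have /hasP[p ps /eqP e] :
      has (fun p => (elem_type 0 p : seq bool) == val t) (star : seq elem).
    by move: (val t) ts; apply/allP; vm_compute.
  by exists p, [::]; split=> //; apply: val_inj.
have step j y : y \in types_at k -> t = child j y -> exists p w,
    [/\ p \in (star : seq elem), size w = k.+1 & t = elem_type k.+1 (refine p w)].
  move=> /IHk[p [w [ps sw ->]]] ->; exists p, (rcons w j); split=> //.
    by rewrite size_rcons sw.
  rewrite /refine -cats1 foldl_cat /= elem_type_half //.
  by rewrite -/(refine p w) unit_refine unit_star.
rewrite [types_at _]/= finset.in_setU => /orP[] /imsetP[y yk tE].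
  exact: (step false y).
exact: (step true y).
Qed.

(** * Iterated bisection *)

Fixpoint pieces (n : nat) (p : elem) : seq elem :=
  if n is n'.+1 then map (half_elem false) (pieces n' p) ++ map (half_elem true) (pieces n' p)
  else [:: p].

Lemma unit_pieces n p q : unit_elem p -> q \in pieces n p -> unit_elem q.
Proof.
move=> up; elim: n q => [|n IHn] q /=; first by rewrite inE => /eqP->.
by rewrite mem_cat => /orP[] /mapP[r /IHn ur ->]; rewrite unit_half.
Qed.

Lemma uniq_pieces n p : unit_elem p -> uniq (pieces n p).
Proof.
move=> up; elim: n => //= n IHn.
rewrite cat_uniq !map_inj_uniq ?IHn ?andbT //; try exact: half_inj.
apply/hasPn => _ /mapP[q qn ->]; apply/negP => /mapP[r rn /esym].
by apply: half_neq; exact: unit_pieces rn.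
Qed.

(** The recursion of [pieces] peels off the last bisection; inductions along types and masses need
    the first one. *)
Lemma pieces_cat n p : perm_eq (pieces n.+1 p)
  (pieces n (half_elem false p) ++ pieces n (half_elem true p)).
Proof.
elim: n => // n IHn.
have mm m q : pieces m.+1 q = map (half_elem false) (pieces m q) ++ map (half_elem true) (pieces m q).
  by [].
rewrite (mm n.+1) (permPl (perm_cat (perm_map _ IHn) (perm_map _ IHn))).
by rewrite !mm !map_cat; rewrite -!catA perm_cat2l perm_catCA.
Qed.

Lemma pieces_sum (V : nmodType) n p (F : elem -> V) :
  \sum_(q <- pieces n.+1 p) F q
  = \sum_(q <- pieces n (half_elem false p)) F q + \sum_(q <- pieces n (half_elem true p)) F q.
Proof. by rewrite (perm_big _ (pieces_cat n p)) big_cat. Qed.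

Lemma mem_pieces_refine p w : refine p w \in pieces (size w) p.
Proof.
elim: w p => [|j w IHw] p; first by rewrite inE.
rewrite (perm_mem (pieces_cat _ _)) mem_cat.
by have := IHw (half_elem j p); case: j => ->; rewrite ?orbT.
Qed.


(** * Geometry of the dragon *)

Section Plane.
Context {R : realType}.
Implicit Types (x y z : R * R) (k : nat) (p q h : elem) (j : bool).

(** The squared Euclidean distance is scaled by exactly [2 ^- k] by a map of level [k], without
    square roots. *)
Definition dist2 x y : R := (x.1 - y.1) ^+ 2 + (x.2 - y.2) ^+ 2.

Definition act p x : R * R :=
  (p.1.1%:~R * x.1 - p.1.2%:~R * x.2 + p.2.1%:~R,
   p.1.1%:~R * x.2 + p.1.2%:~R * x.1 + p.2.2%:~R).

(* [levy_f1] is the multiplication by [(1 - i)^-1]. *)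
Definition lvl k p x : R * R := iter k levy_f1 (act p x).

(** The right isosceles triangle T with hypotenuse from (0, 0) to (1, 0) and apex (1/2, 1/2). *)
Definition triangle : set (R * R) :=
  [set x | [/\ 0 <= x.2, x.2 <= x.1 & x.1 + x.2 <= 1]].

(** The similarities of T onto its left half ([false]) and its right half ([true]), cut along the
    altitude. *)
Definition half_map j x : R * R :=
  if j then (1 - (x.1 + x.2) / 2, (x.1 - x.2) / 2)
  else ((1 - x.1 + x.2) / 2, (1 - x.1 - x.2) / 2).

Definition copy_map j : R * R -> R * R := if j then levy_f2 else levy_f1.

Definition tri k p : set (R * R) := lvl k p @` triangle.

Lemma dist2_ge0 x y : 0 <= dist2 x y.
Proof. by rewrite addr_ge0 ?sqr_ge0. Qed.

Lemma dist2C x y : dist2 x y = dist2 y x.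
Proof. by rewrite /dist2; ring. Qed.

Lemma dist2_coord x y c : 0 < c -> dist2 x y < c ^+ 2 ->
  [/\ x.1 - c < y.1, y.1 < x.1 + c, x.2 - c < y.2 & y.2 < x.2 + c].
Proof.
rewrite /dist2 => c0 lt.
have sq (d : R) : d ^+ 2 < c ^+ 2 -> -c < d < c.
  by rewrite -(real_normK (num_real d)) ltr_pXn2r ?nnegrE ?normr_ge0 ?ltW // ltr_norml.
have /sq/andP[] : (x.1 - y.1) ^+ 2 < c ^+ 2.
  by apply: le_lt_trans lt; rewrite lerDl sqr_ge0.
have /sq/andP[] : (x.2 - y.2) ^+ 2 < c ^+ 2.
  by apply: le_lt_trans lt; rewrite lerDr sqr_ge0.
by move=> *; split; lra.
Qed.

Lemma act_mul p q x : act (mul_elem p q) x = act p (act q x).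
Proof.
case: p q => [[u1 u2] [b1 b2]] [[v1 v2] [c1 c2]]; rewrite /act /mul_elem /=.
by rewrite !(rmorphD, rmorphN, rmorphM) /=; congr (_, _); ring.
Qed.

Lemma act_id x : act id_elem x = x.
Proof. by case: x => a b; rewrite /act /=; congr (_, _); ring. Qed.

Lemma lvl_mul k p q x : lvl k (mul_elem p q) x = lvl k p (act q x).
Proof. by rewrite /lvl act_mul. Qed.

Lemma lvl_half k j p x : lvl k.+1 (half_elem j p) x = lvl k p (half_map j x).
Proof.
rewrite /lvl iterSr; congr (iter k _ _).
case: p x j => [[u1 u2] [b1 b2]] [a b] [];
  rewrite /levy_f1 /act /half_elem /half_map /= !(rmorphD, rmorphN) /=;
  by congr (_, _); field.
Qed.

Lemma lvl_copy k j p x : lvl k.+1 (copy_elem j p) x = lvl k p (copy_map j x).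
Proof.
rewrite /lvl iterSr; congr (iter k _ _).
case: p x j => [[u1 u2] [b1 b2]] [a b] [];
  rewrite /levy_f1 /levy_f2 /act /copy_elem /copy_map /= ?/levy_f1 ?/levy_f2 /=
     !(rmorphD, rmorphN) /=;
  by congr (_, _); field.
Qed.

Lemma dist2_act p x y : unit_elem p -> dist2 (act p x) (act p y) = dist2 x y.
Proof.
case: p => [[u1 u2] [b1 b2]] /unit_elemP[] /= [-> ->];
  rewrite /dist2 /act /=; ring.
Qed.

Lemma dist2_lvl k p x y : unit_elem p ->
  dist2 (lvl k p x) (lvl k p y) = dist2 x y / 2 ^+ k.
Proof.
move=> up; rewrite -(dist2_act x y up) /lvl.
elim: k (act p x) (act p y) => [|k IHk] a b; first by rewrite expr0 divr1.
rewrite !iterSr IHk exprS invfM mulrA; congr (_ * _).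
by rewrite /dist2 /levy_f1 /=; field.
Qed.

Lemma triangle_half_map j x : triangle x -> triangle (half_map j x).
Proof.
by case: x j => a b []; rewrite /triangle /half_map /= => -[? ? ?]; split; lra.
Qed.

Lemma triangle_split x : triangle x ->
  exists j y, triangle y /\ x = half_map j y.
Proof.
case: x => a b; rewrite /triangle /half_map /= => -[? ? ?].
have [le|lt] := lerP a (1/2).
  exists false, (1 - a - b, a - b); split; first by split=> /=; lra.
  by congr (_, _); rewrite /=; lra.
exists true, (1 - a + b, 1 - a - b); split; first by split=> /=; lra.
by congr (_, _); rewrite /=; lra.
Qed.

Lemma tri_split k p x : tri k p x -> exists j, tri k.+1 (half_elem j p) x.
Proof.
by move=> [y /triangle_split[j [z [zT ->]]] <-]; exists j, z; rewrite ?lvl_half.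
Qed.

Lemma tri_half k j p : tri k.+1 (half_elem j p) `<=` tri k p.
Proof.
move=> _ [y yT <-]; rewrite lvl_half.
by exists (half_map j y) => //; exact: triangle_half_map.
Qed.

Lemma tri_refine k p w : tri (size w + k) (refine p w) `<=` tri k p.
Proof.
elim: w k p => [|j w IHw] k p //= x.
by rewrite addSnnS => /IHw/tri_half.
Qed.

Lemma triangle_dist2 x y : triangle x -> triangle y -> dist2 x y <= 1.
Proof.
case: x y => [a b] [c d]; rewrite /triangle /dist2 /= => -[? ? ?] [? ? ?].
(* On T the sum and the difference of the coordinates lie in [0, 1]. With X and Y the coordinate
   differences, (X + Y)^2 and (X - Y)^2 are at most 1, and they add up to 2 (X^2 + Y^2). *)
have s1 : 0 <= (1 - (a - c + (b - d))) * (1 + (a - c + (b - d))).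
  by apply: mulr_ge0; lra.
have s2 : 0 <= (1 - (a - c - (b - d))) * (1 + (a - c - (b - d))).
  by apply: mulr_ge0; lra.
lra.
Qed.

Lemma intr_gtN (n : int) (k : nat) : - k%:R < n%:~R :> R -> - k%:Z < n.
Proof. by rewrite -[k%:R]/(k%:Z%:~R) -rmorphN ltr_int. Qed.

Lemma intr_lt (n : int) (k : nat) : n%:~R < k%:R :> R -> n < k%:Z.
Proof. by rewrite -[k%:R]/(k%:Z%:~R) ltr_int. Qed.

(** For each of the four units, the coordinate bounds leave finitely many integer translations, and
    these are inspected one by one. *)
Lemma star_near h x y : unit_elem h -> triangle x -> triangle y ->
  dist2 x (act h y) < (1/10) ^+ 2 -> h \in (star : seq elem).
Proof.
case: h x y => [[u1 u2] [b1 b2]] [a b] [c d] uh.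
rewrite /triangle /= => -[? ? ?] [? ? ?].
move=> /(dist2_coord (ltac:(lra) : 0 < 1 / 10 :> R)).
case/unit_elemP: uh => /= -[-> ->]; rewrite /act /=.
- rewrite !mul1r !mul0r subr0 addr0 => -[? ? ? ?].
  have := @intr_gtN b1 2 ltac:(lra); have := @intr_lt b1 2 ltac:(lra).
  have := @intr_gtN b2 1 ltac:(lra); have := @intr_lt b2 1 ltac:(lra).
  clear=> ? ? ? ?; have -> : b2 = 0 by lia.
  by have [->|[->|->]] : b1 = -1 \/ b1 = 0 \/ b1 = 1 by lia.
- rewrite !mul1r !mul0r sub0r add0r => -[? ? ? ?].
  have := @intr_gtN b1 1 ltac:(lra); have := @intr_lt b1 2 ltac:(lra).
  have := @intr_gtN b2 2 ltac:(lra); have := @intr_lt b2 1 ltac:(lra).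
  clear=> ? ? ? ?.
  have [->|->] : b1 = 0 \/ b1 = 1 by lia.
    by have [->|->] : b2 = -1 \/ b2 = 0 by lia.
  by have [->|->] : b2 = -1 \/ b2 = 0 by lia.
- rewrite !rmorphN !mulN1r !mul0r subr0 addr0 => -[? ? ? ?].
  have B1 := @intr_gtN b1 1 ltac:(lra); have B2 := @intr_lt b1 3 ltac:(lra).
  have B3 := @intr_gtN b2 1 ltac:(lra); have B4 := @intr_lt b2 2 ltac:(lra).
  (* The translations (0, 1) and (2, 1) pass the separate bounds on the coordinates; the slanted
     sides of the triangles exclude them. *)
  have n02 : b1%:~R = 0 :> R -> b2%:~R = 1 :> R -> False by move=> *; lra.
  have n22 : b1%:~R = 2 :> R -> b2%:~R = 1 :> R -> False by move=> *; lra.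
  have [e1|[e1|e1]] : b1 = 0 \/ b1 = 1 \/ b1 = 2 by (clear -B1 B2; lia).
  + have [e2|e2] : b2 = 0 \/ b2 = 1 by (clear -B3 B4; lia).
      by rewrite e1 e2.
    by case: n02; rewrite ?e1 ?e2.
  + by rewrite e1; have [->|->] : b2 = 0 \/ b2 = 1 by (clear -B3 B4; lia).
  + have [e2|e2] : b2 = 0 \/ b2 = 1 by (clear -B3 B4; lia).
      by rewrite e1 e2.
    by case: n22; rewrite ?e1 ?e2.
- rewrite !rmorphN !mulN1r !mul0r => -[? ? ? ?].
  have := @intr_gtN b1 1 ltac:(lra); have := @intr_lt b1 2 ltac:(lra).
  have := @intr_gtN b2 1 ltac:(lra); have := @intr_lt b2 2 ltac:(lra).
  clear=> ? ? ? ?.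
  have [->|->] : b1 = 0 \/ b1 = 1 by lia.
    by have [->|->] : b2 = 0 \/ b2 = 1 by lia.
  by have [->|->] : b2 = 0 \/ b2 = 1 by lia.
Qed.

(** The disc of radius 1/10 around (1/2, 1/4) lies in the interior of T, so no other triangle of the
    tiling meets it. *)
Lemma center_near h y : unit_elem h -> triangle y ->
  dist2 (1/2, 1/4) (act h y) < (1/10) ^+ 2 -> h = id_elem.
Proof.
case: h y => [[u1 u2] [b1 b2]] [c d] uh; rewrite /triangle /= => -[? ? ?].
move=> /(dist2_coord (ltac:(lra) : 0 < 1 / 10 :> R)).
case/unit_elemP: uh => /= -[-> ->]; rewrite /act /=.
- rewrite !mul1r !mul0r subr0 addr0 => -[? ? ? ?].
  have := @intr_gtN b1 1 ltac:(lra); have := @intr_lt b1 1 ltac:(lra).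
  have := @intr_gtN b2 1 ltac:(lra); have := @intr_lt b2 1 ltac:(lra).
  clear=> ? ? ? ?; have -> : b2 = 0 by lia.
  by have -> : b1 = 0 by lia.
- rewrite !mul1r !mul0r sub0r add0r => -[? ? ? ?].
  have B1 := @intr_gtN b1 0 ltac:(lra); have B2 := @intr_lt b1 2 ltac:(lra).
  have B3 := @intr_gtN b2 1 ltac:(lra); have B4 := @intr_lt b2 1 ltac:(lra).
  have e1 : b1%:~R = 1 :> R by have -> : b1 = 1 by (clear -B1 B2; lia).
  have e2 : b2%:~R = 0 :> R by have -> : b2 = 0 by (clear -B3 B4; lia).
  by exfalso; lra.
- rewrite !rmorphN !mulN1r !mul0r subr0 addr0 => -[? ? ? ?].
  have B3 := @intr_gtN b2 0 ltac:(lra); have B4 := @intr_lt b2 1 ltac:(lra).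
  exfalso; clear -B3 B4; lia.
- rewrite !rmorphN !mulN1r !mul0r => -[? ? ? ?].
  have B1 := @intr_gtN b1 1 ltac:(lra); have B2 := @intr_lt b1 1 ltac:(lra).
  have B3 := @intr_gtN b2 0 ltac:(lra); have B4 := @intr_lt b2 2 ltac:(lra).
  have e1 : b1%:~R = 0 :> R by have -> : b1 = 0 by (clear -B1 B2; lia).
  have e2 : b2%:~R = 1 :> R by have -> : b2 = 1 by (clear -B3 B4; lia).
  by exfalso; lra.
Qed.

End Plane.


(** * Squared distance and the topology of the plane *)

Section Distance.
Context {R : realType}.
Implicit Types (x y z : R * R) (e : R).

(** A triangle inequality for squares, from the parallelogram identity. *)
Lemma dist2_triangle x y z : dist2 x z <= 2 * (dist2 x y + dist2 y z).
Proof.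
rewrite /dist2 -subr_ge0.
have -> : 2 * ((x.1 - y.1) ^+ 2 + (x.2 - y.2) ^+ 2 + ((y.1 - z.1) ^+ 2 + (y.2 - z.2) ^+ 2)) -
  ((x.1 - z.1) ^+ 2 + (x.2 - z.2) ^+ 2) =
  (x.1 - y.1 - (y.1 - z.1)) ^+ 2 + (x.2 - y.2 - (y.2 - z.2)) ^+ 2 by ring.
by rewrite addr_ge0 ?sqr_ge0.
Qed.

Lemma div_exp2_small (c e : R) : 0 < e -> exists k0, forall k, (k0 <= k)%N -> c / 2 ^+ k < e.
Proof.
move=> e0; pose k0 := Num.bound `|c / e|; exists k0 => k kk.
rewrite ltr_pdivrMr ?exprn_gt0 // mulrC -ltr_pdivrMr //.
apply: lt_le_trans (_ : k0%:R <= _).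
  by rewrite (le_lt_trans (ler_norm _)) // archi_boundP ?normr_ge0.
apply: le_trans (_ : k%:R <= _); first by rewrite ler_nat.
by rewrite -natrX ler_nat ltnW // ltn_expl.
Qed.

Lemma dist2_nbhs x e : 0 < e -> nbhs x [set y | dist2 x y < e].
Proof.
move=> e0; exists (ball x.1 (Num.min 1 (e / 2)), ball x.2 (Num.min 1 (e / 2))).
  by split; apply: nbhsx_ballx; rewrite lt_min ltr01 divr_gt0.
case=> a b [] /=; rewrite /ball /= !lt_min => /andP[a1 a2] /andP[b1 b2].
have sq (d : R) : `|d| < 1 -> `|d| < e / 2 -> d ^+ 2 < e / 2.
  move=> d1 d2; rewrite -(real_normK (num_real d)) expr2.
  by apply: le_lt_trans d2; rewrite ler_piMr // ltW.
by rewrite /dist2 /= [ltRHS](splitr e) ltrD // sq.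
Qed.

Lemma nbhs_dist2 x (A : set (R * R)) : nbhs x A ->
  exists2 e, 0 < e & forall y, dist2 x y < e -> A y.
Proof.
move=> /nbhs_ballP[e /= e0 sub]; exists (e ^+ 2); first exact: exprn_gt0.
move=> y /(dist2_coord e0)[? ? ? ?]; apply: sub.
by split; rewrite /ball /= ltr_norml; apply/andP; split; lra.
Qed.

Lemma closureP x (A : set (R * R)) :
  closure A x <-> forall e, 0 < e -> exists2 y, A y & dist2 x y < e.
Proof.
split=> [cl e e0|h B /nbhs_dist2[e e0 sub]].
  by have [y [Ay ?]] := cl _ (dist2_nbhs x e0); exists y.
by have [y Ay /sub ?] := h e e0; exists y.
Qed.

Lemma boundaryP x (A : set (R * R)) : closed A ->
  boundary A x <-> A x /\ forall e, 0 < e -> exists2 y, ~ A y & dist2 x y < e.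
Proof.
move=> cA; rewrite /boundary -(closure_id A).1 //.
split=> -[Ax h]; split=> //.
  move=> e e0; apply: contrapT => none; apply: h.
  apply: filterS (dist2_nbhs x e0) => y ye.
  by apply: contrapT => nAy; apply: none; exists y.
by move=> /nbhs_dist2[e e0 sub]; have [y nAy /sub] := h e e0.
Qed.

Lemma compact_dist2_bounded (A : set (R * R)) y : compact A ->
  exists2 C, 0 <= C & forall x, A x -> dist2 x y <= C.
Proof.
move=> cA.
have cont : continuous (dist2 ^~ y).
  move=> x; rewrite /dist2 /=.
  apply: cvgD; rewrite expr2; apply: cvgM; apply: cvgB; try exact: cvg_cst;
    by (exact: cvg_fst || exact: cvg_snd).
have /compact_bounded[M [_ hM]] : compact (dist2 ^~ y @` A).
  by apply: continuous_compact => //; apply: continuous_subspaceT.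
exists (`|M| + 1); first by rewrite addr_ge0.
move=> x Ax; apply: le_trans (ler_norm _) _.
by apply: hM; [rewrite (le_lt_trans (ler_norm _)) // ltrDl | exists x].
Qed.

End Distance.


(** * Types of triangles and position with respect to the dragon *)

Section Dragon.
Context {R : realType} (K : set (R * R)) (dragonK : is_levy_dragon K).
Implicit Types (x y z : R * R) (k : nat) (p q h : elem) (j : bool).

Lemma dragon_copy j x : K x -> K (copy_map j x).
Proof.
case: dragonK => _ _ KE Kx; rewrite KE.
by case: j; [right | left]; exists x.
Qed.

Lemma dragon_split x : K x -> exists j y, K y /\ x = copy_map j y.
Proof.
case: dragonK => _ _ KE; rewrite {1}KE => -[[y Ky <-]|[y Ky <-]].
  by exists false, y.
by exists true, y.
Qed.

Lemma dragon_closed : closed K.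
Proof.
by case: dragonK => _ cK _; apply: compact_closed => //; exact: norm_hausdorff.
Qed.

Lemma dragon_approx k x : K x -> exists p y, [/\ p \in levy_approx k, K y & x = lvl k p y].
Proof.
move=> Kx; elim: k => [|k [p [y [pk Ky ->]]]].
  by exists id_elem, x; rewrite /lvl /= act_id.
have [j [z [Kz ->]]] := dragon_split Ky.
exists (copy_elem j p), z; split; rewrite ?lvl_copy //.
by rewrite mem_approxS ?(unit_approx pk).
Qed.

Lemma approxSP k p : p \in levy_approx k.+1 -> exists j q, q \in levy_approx k /\ p = copy_elem j q.
Proof.
rewrite /levy_approx -/levy_approx mem_cat => /orP[] /mapP[q qk ->]; first by exists false, q.
by exists true, q.
Qed.

Lemma approx_dragon k p x : p \in levy_approx k -> K x -> K (lvl k p x).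
Proof.
elim: k p x => [|k IHk] p x.
  by rewrite inE => /eqP-> Kx; rewrite /lvl /= act_id.
move=> /approxSP[j [q [qk ->]]] Kx; rewrite lvl_copy.
by apply: IHk => //; exact: dragon_copy.
Qed.

Definition in_star x :=
  exists h y, [/\ h \in (star : seq elem), triangle y & x = act h y].

(** Each dragon map sends every triangle of the star onto a half of a triangle of the star, so the
    star is mapped into itself; the cases are checked by computation. *)
Lemma copy_star j h : h \in (star : seq elem) ->
  exists i g, g \in (star : seq elem) /\
              mul_elem (copy_elem j id_elem) h = half_elem i g.
Proof.
move=> hs.
have : all (fun h => [exists i : bool, has (fun g =>
    mul_elem (copy_elem j id_elem) h == half_elem i g) star]) star.
  apply/allP => g gs; apply/existsP.
  have : has (fun i => has (fun g' => mul_elem (copy_elem j id_elem) g ==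
           half_elem i g') star) [:: false; true].
    by move: g gs; apply/allP; case: j; vm_compute.
  by case/hasP => i _ ?; exists i.
by move=> /allP/(_ h hs)/existsP[i /hasP[g gs /eqP e]]; exists i, g.
Qed.

Lemma copy_map_star j x : in_star x -> in_star (copy_map j x).
Proof.
move=> [h [y [hs yT ->]]]; have [i [g [gs e]]] := copy_star j hs.
exists g, (half_map i y); split=> //; first exact: triangle_half_map.
have := lvl_copy 0 j id_elem (act h y); rewrite -lvl_mul e lvl_half.
by rewrite {1}/lvl /= => ->; rewrite /lvl /= act_id.
Qed.

Lemma approx_star k p x : p \in levy_approx k -> in_star x -> in_star (lvl k p x).
Proof.
elim: k p x => [|k IHk] p x.
  by rewrite inE => /eqP-> sx; rewrite /lvl /= act_id.
move=> /approxSP[j [q [qk ->]]] sx; rewrite lvl_copy.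
by apply: IHk => //; exact: copy_map_star.
Qed.

Lemma triangle0 : triangle (0, 0 : R).
Proof. by rewrite /triangle /=; split; lra. Qed.

(* Proximity to the star, not membership in it, is all that is needed; this
   avoids any closedness argument. *)
Lemma dragon_near_star x e : K x -> 0 < e -> exists2 y, in_star y & dist2 x y < e.
Proof.
move=> Kx e0; have [_ cK _] := dragonK.
have [C C0 hC] := compact_dist2_bounded (0, 0) cK.
have [k hk] := div_exp2_small C e0.
have [p [y [pk Ky xE]]] := dragon_approx k Kx.
exists (lvl k p (0, 0)).
  apply: approx_star => //; exists id_elem, (0, 0); rewrite act_id; split=> //.
  exact: triangle0.
rewrite xE dist2_lvl ?(unit_approx pk) //.
by apply: le_lt_trans (hk k (leqnn k)); rewrite ler_pM2r ?invr_gt0 ?exprn_gt0 // hC.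
Qed.

(** A nonzero type at level [k] provides a neighbour in the approximation, hence a small copy of K
    at distance of order 2^(-k/2) from [x]; K is closed. *)
Lemma nonzero_types_dragon x k0 :
  (forall k, (k0 <= k)%N -> exists p,
     [/\ unit_elem p, tri k p x & elem_type k p <> zero_type]) -> K x.
Proof.
move=> hx; have [[w Kw] _ _] := dragonK.
apply: dragon_closed; apply/closureP => e e0.
(* [D] bounds the squared distance from any point of T to the image of [w] under any map of the
   star. *)
pose D := 2 * (1 + 2 * (1 + \sum_(h <- star) dist2 (0, 0) (act h w))).
have [k1 hk1] := div_exp2_small D e0.
pose k := maxn k0 k1.
have [p [up [t tT <-]]] := hx k (leq_maxl _ _).
move=> /elem_type_neq0[h hs pk].
exists (lvl k (mul_elem p h) w); first exact: approx_dragon.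
rewrite lvl_mul dist2_lvl //.
apply: le_lt_trans (hk1 k (leq_maxr _ _)).
rewrite ler_pM2r ?invr_gt0 ?exprn_gt0 //.
apply: le_trans (dist2_triangle _ (0, 0) _) _.
rewrite ler_pM2l // lerD ?triangle_dist2 //; first exact: triangle0.
apply: le_trans (_ : \sum_(h <- star) dist2 (0, 0) (act h w) <= _).
  rewrite (big_rem h) //= lerDl.
  by rewrite big_seq sumr_ge0 // => i _; exact: dist2_ge0.
have : 0 <= \sum_(h <- star) dist2 (0, 0) (act h w).
  by rewrite sumr_ge0 // => i _; exact: dist2_ge0.
lra.
Qed.

Lemma full_type_dragon k p : unit_elem p -> elem_type k p = full_type ->
  tri k p `<=` K.
Proof.
move=> up pf x xp; apply: (@nonzero_types_dragon _ k) => m km.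
have : exists w, size w = (m - k)%N /\ tri (size w + k) (refine p w) x.
  elim: (m - k)%N => [|n [w [sw xw]]]; first by exists [::].
  have [j xj] := tri_split xw.
  exists (rcons w j); rewrite size_rcons sw; split=> //.
  by rewrite /refine -cats1 foldl_cat -sw.
move=> [w [sw]]; rewrite sw subnK // => xw.
exists (refine p w); rewrite unit_refine; split=> //.
rewrite -(subnK km) -sw elem_type_refine // pf.
have -> : descend full_type w = full_type.
  by elim: w {sw xw} => //= j w IHw; rewrite child_full.
by [].
Qed.

(** Distances are measured in the frame of [p], where its neighbours are the elements of [star]. *)
Lemma dist2_pull k p q x y : unit_elem p ->
  dist2 (lvl k p x) (lvl k q y) = dist2 x (act (mul_elem (inv_elem p) q) y) / 2 ^+ k.
Proof.
move=> up; rewrite -[q in LHS]id_mul -(mul_inv up) mul_elemA lvl_mul.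
by rewrite dist2_lvl.
Qed.

(** The central point of the triangle is not in K: otherwise it lies in a copy [q] of K, hence near
    a triangle [mul_elem q h] of the star of [q]. By [center_near] that triangle is [p], so [q] is a
    neighbour of [p] in the approximation. *)
Lemma zero_type_dragon k p : unit_elem p -> elem_type k p = zero_type ->
  exists2 y, tri k p y & ~ K y.
Proof.
move=> up pz; exists (lvl k p (1/2, 1/4)).
  by exists (1/2, 1/4) => //; rewrite /triangle /=; split; lra.
move=> /(dragon_approx k)[q [z [qk Kz e]]].
have [_ [h [t [hs tT ->]]] zt] := dragon_near_star Kz (exprn_gt0 2 (ltac:(lra) : 0 < 1/10 :> R)).
have := congr1 (fun y => dist2 y (lvl k (mul_elem q h) t)) e.
rewrite /= dist2_pull // lvl_mul dist2_lvl ?(unit_approx qk) //.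
move/(mulIf _) => /(_ (ltac:(by rewrite invr_neq0 // expf_neq0))) e2.
have uqh : unit_elem (mul_elem q h).
  by rewrite unit_mul ?(unit_approx qk) ?unit_star.
have := @center_near _ (mul_elem (inv_elem p) (mul_elem q h)) t.
rewrite e2 => /(_ (unit_mul (unit_inv up) uqh) tT zt) e3.
have pE : mul_elem q h = p.
  by rewrite -[LHS]id_mul -(mul_inv up) mul_elemA e3 mul_id.
have := elem_type_zero pz (star_inv hs).
by rewrite -pE mul_elemA (mul_inv (unit_star hs)) mul_id qk.
Qed.

(** An integer translation moves the point into the unit square, which its two diagonals cut into
    four copies of T; bisection reaches the finer levels. *)
Lemma plane_cover k x : exists p, unit_elem p /\ tri k p x.
Proof.
elim: k => [|k [p [up /tri_split[j xj]]]]; last first.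
  by exists (half_elem j p); rewrite unit_half.
case: x => a b.
pose m := Num.floor a; pose n := Num.floor b.
have := floor_itv a; have := floor_itv b; rewrite -/m -/n !rmorphD /=.
move=> /andP[n1 n2] /andP[m1 m2].
have [l1|l1] := lerP (b - n%:~R) (a - m%:~R);
have [l2|l2] := lerP (a - m%:~R + (b - n%:~R)) 1.
- exists ((1, 0), (m, n)); split=> //; exists (a - m%:~R, b - n%:~R).
    by rewrite /triangle /=; split; lra.
  by rewrite /lvl /act /=; congr (_, _); ring.
- exists ((0, 1), (m + 1, n)); split=> //; exists (b - n%:~R, 1 - (a - m%:~R)).
    by rewrite /triangle /=; split; lra.
  by rewrite /lvl /act /= rmorphD /=; congr (_, _); ring.
- exists ((0, -1), (m, n + 1)); split=> //; exists (1 - (b - n%:~R), a - m%:~R).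
    by rewrite /triangle /=; split; lra.
  by rewrite /lvl /act /= rmorphD /=; congr (_, _); ring.
- exists ((-1, 0), (m + 1, n + 1)); split=> //; exists (1 - (a - m%:~R), 1 - (b - n%:~R)).
    by rewrite /triangle /=; split; lra.
  by rewrite /lvl /act /= !rmorphD /=; congr (_, _); ring.
Qed.

(** A triangle [s] near [x], in the star of an element of the approximation, has nonzero type. If
    its type is full, a triangle through a point outside K near [x] is a neighbour of [s], so its
    type is nonzero, and not full either. *)
Lemma boundary_cover k x : boundary K x -> exists p, 
  [/\ unit_elem p, elem_type k p \notin Sa
    & exists2 y, tri k p y & dist2 x y < 1 / 2 ^+ k].
Proof.
move=> /(boundaryP x dragon_closed)[Kx bx].
(* Two such distances combine through [dist2_triangle] to (1/10)^2, the bound in [star_near]. *)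
have e0 : 0 < (1/20) ^+ 2 :> R by rewrite exprn_gt0 ?divr_gt0.
have p2 : 0 < 2 ^+ k :> R by rewrite exprn_gt0.
have small : (1/20) ^+ 2 / 2 ^+ k < 1 / 2 ^+ k :> R by rewrite ltr_pM2r ?invr_gt0 //; lra.
have [q [z [qk Kz xE]]] := dragon_approx k Kx.
have [_ [h [t [hs tT ->]]] zt] := dragon_near_star Kz e0.
pose s := mul_elem q h.
have us : unit_elem s by rewrite unit_mul ?(unit_approx qk) ?unit_star.
have xs : dist2 x (lvl k s t) < (1/20) ^+ 2 / 2 ^+ k.
  by rewrite xE lvl_mul dist2_lvl ?(unit_approx qk) // ltr_pM2r ?invr_gt0.
have s0 : elem_type k s <> zero_type.
  move=> /elem_type_zero/(_ (star_inv hs)).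
  by rewrite mul_elemA (mul_inv (unit_star hs)) mul_id qk.
case: (boolP (elem_type k s \in Sa)) => [/SaP[//|sf]|nSa]; last first.
  by exists s; split=> //; exists (lvl k s t); [exists t | exact: lt_trans small].
have [y nKy xy] := bx _ (divr_gt0 e0 p2).
have [p [up [u uT uy]]] := plane_cover k y.
exists p; split=> //; last first.
  by exists y; [exists u | exact: lt_trans small].
have ps : mul_elem (inv_elem s) p \in (star : seq elem).
  apply: star_near (unit_mul (unit_inv us) up) tT uT _.
  rewrite -(ltr_pM2r (x := (2 ^+ k)^-1)) ?invr_gt0 // -dist2_pull // uy.
  apply: le_lt_trans (dist2_triangle _ x _) _.
  have -> : (1 / 10) ^+ 2 / 2 ^+ k = 2 * ((1/20) ^+ 2 / 2 ^+ k + (1/20) ^+ 2 / 2 ^+ k) :> R.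
    by field; rewrite expf_neq0.
  by rewrite ltr_pM2l // (dist2C _ x) -/s ltrD // dist2C.
apply/negP => /SaP[|pf].
  have ids : id_elem \in (star : seq elem) by [].
  move=> /elem_type_zero/(_ ids)/negP; apply.
  have := elem_type_full sf ps.
  by rewrite -mul_elemA (mul_inv us) id_mul mul_id.
by apply: nKy; apply: (full_type_dragon up pf); exists u.
Qed.

End Dragon.

(** * Spectral radius and counting *)

Section IterationGrowth.
Context {C : numClosedFieldType} (n : nat) (A : 'M[C]_n.+1).

Definition growth_bounded (m : C) (y : 'cV[C]_n.+1) :=
  exists2 c, 0 <= c & forall k i, `|iter k (mulmx A) y i 0| <= c * m ^+ k.

Lemma iter_mulmxB k z (y : 'cV[C]_n.+1) :
  iter k.+1 (mulmx A) y
  = iter k (mulmx A) (A *m y - z *: y) + z *: iter k (mulmx A) y.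
Proof.
have linB (u v : 'cV[C]_n.+1) m :
    iter m (mulmx A) (u - v) = iter m (mulmx A) u - iter m (mulmx A) v.
  by elim: m => //= m ->; rewrite mulmxBr.
have linZ (u : 'cV[C]_n.+1) m : iter m (mulmx A) (z *: u) = z *: iter m (mulmx A) u.
  by elim: m => //= m ->; rewrite scalemxAr.
by rewrite linB linZ subrK iterSr.
Qed.

(** The iterates of [y] satisfy a first-order recurrence with ratio [z], whose inhomogeneous term is
    bounded by [c * m ^+ k]. *)
Lemma growth_bounded_step m z y : `|z| < m ->
  growth_bounded m (A *m y - z *: y) -> growth_bounded m y.
Proof.
move=> zm [c c0 hc]; have m0 : 0 < m := le_lt_trans (normr_ge0 z) zm.
have mz : 0 < m - `|z| by rewrite subr_gt0.
(* This constant C bounds the initial value and satisfies [c + |z| C <= m C], as the induction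
   requires. *)
exists (\sum_i `|y i 0| + c / (m - `|z|)).
  by rewrite addr_ge0 ?sumr_ge0 // divr_ge0 // ltW.
elim=> [|k IHk] i.
  rewrite /= expr0 mulr1 (bigD1 i) //= -addrA lerDl addr_ge0 ?sumr_ge0 //.
  by rewrite divr_ge0 // ltW.
rewrite (iter_mulmxB k z) !mxE; apply: le_trans (ler_normD _ _) _.
rewrite normrM; apply: le_trans (lerD (hc k i) (ler_wpM2l (normr_ge0 z) (IHk i))) _.
rewrite exprS !mulrA -mulrDl; apply: ler_wpM2r; first by rewrite exprn_ge0 // ltW.
rewrite -subr_ge0.
have -> : (\sum_i `|y i 0| + c / (m - `|z|)) * m -
    (c + `|z| * (\sum_i `|y i 0| + c / (m - `|z|)))
    = (m - `|z|) * (\sum_i `|y i 0|).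
  by field; rewrite gt_eqF.
by rewrite mulr_ge0 ?sumr_ge0 // ltW.
Qed.

(* By Cayley-Hamilton [y] is killed by a product of factors [A - z]; each of
   them is a first-order recurrence for the sequence [A ^+ k *m y]. *)
Lemma growth_bounded_eigen m y :
  (forall z, eigenvalue A z -> `|z| < m) -> growth_bounded m y.
Proof.
move=> hm; have [r rE] := closed_field_poly_normal (char_poly A).
rewrite (monicP (char_poly_monic A)) scale1r in rE.
have hr z : z \in r -> `|z| < m.
  by move=> zr; apply: hm; rewrite eigenvalue_root_char rE root_prod_XsubC.
have gen (s : seq C) : {subset s <= r} ->
    growth_bounded m (foldr (fun z v => A *m v - z *: v) y s) -> growth_bounded m y.
  elim: s => //= z s IHs sr /growth_bounded_step g; apply: IHs.
    by move=> u us; apply: sr; rewrite inE us orbT.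
  by apply/g/hr/sr; rewrite inE eqxx.
apply: (gen r) => //.
suff -> : foldr (fun z v => A *m v - z *: v) y r = 0.
  exists 0 => // k i; suff -> : iter k (mulmx A) 0 = 0 :> 'cV[C]_n.+1.
    by rewrite mxE normr0 mul0r.
  by elim: k => //= k ->; rewrite mulmx0.
have -> : foldr (fun z v => A *m v - z *: v) y r
          = horner_mx A (\prod_(z <- r) ('X - z%:P)) *m y.
  elim: {rE hr gen}r => [|z s IHs]; first by rewrite big_nil rmorph1 mul1mx.
  rewrite /= IHs big_cons rmorphM rmorphB /= horner_mx_X horner_mx_C -mulmxE.
  by rewrite -!mulmxA mulmxBl mul_scalar_mx.
by rewrite -rE Cayley_Hamilton mul0mx.
Qed.

End IterationGrowth.

(** * Eigenvalues and the spectral radius *)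

Section SpectralRadius.
Context {R : realType} (n : nat) (A : 'M[R[i]]_n).
Local Notation normc := ComplexField.Normc.normc.

Lemma eigenvalue_le_spectral_radius z : eigenvalue A z -> normc z <= spectral_radius A.
Proof.
move=> ez; apply: ub_le_sup; last by exists z.
have [r rE] := closed_field_poly_normal (char_poly A).
rewrite (monicP (char_poly_monic A)) scale1r in rE.
exists (\sum_(u <- r) normc u) => _ [u /= eu <-].
have ur : u \in r by rewrite -root_prod_XsubC -rE -eigenvalue_root_char.
have nc0 (v : R[i]) : 0 <= normc v by case: v => a b; exact: sqrtr_ge0.
by rewrite (big_rem u) //= lerDl sumr_ge0.
Qed.

Lemma spectral_radius_gt (m : R) : 0 <= m -> m < spectral_radius A ->
  exists2 z, eigenvalue A z & m < normc z.
Proof.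
move=> m0 mA; have [S0|/set0P/negP/negPn/eqP S0] :=
  pselect ([set normc z | z in [set z | eigenvalue A z]] !=set0).
  have [_ [z ez <-] mz] := sup_gt S0 mA.
  by exists z.
(* The supremum of the empty set is 0, which [0 <= m] excludes. *)
by move: mA; rewrite /spectral_radius S0 sup0 ltNge m0.
Qed.

(** [eigenvalue] is about row vectors; the transpose has the same characteristic polynomial and
    provides column eigenvectors. *)
Lemma eigenvalue_super z : eigenvalue A z -> 
  exists w : 'cV[R[i]]_n, w != 0 /\ A *m w = z *: w.
Proof.
rewrite eigenvalue_root_char /root.
have -> : char_poly A = char_poly A^T.
  rewrite /char_poly -det_tr; congr (\det _).
  by rewrite /char_poly_mx linearB /= tr_scalar_mx map_trmx.
rewrite -/(root _ _) -eigenvalue_root_char => /eigenvalueP[v vA v0].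
exists v^T; split; first by rewrite -(inj_eq trmx_inj) trmxK trmx0.
by apply: trmx_inj; rewrite trmx_mul trmxK vA linearZ /= trmxK.
Qed.

End SpectralRadius.

Local Notation normc := ComplexField.Normc.normc.

Lemma normc_ge0 {R : realType} (z : R[i]) : 0 <= normc z.
Proof. by case: z => a b; exact: sqrtr_ge0. Qed.

Lemma growth_spectral_radius {R : realType} n (A : 'M[R[i]]_n) (y : 'cV[R[i]]_n) (m : R) :
  0 < m -> spectral_radius A < m ->
  exists2 c : R, 0 <= c &
    forall k i, normc (iter k (mulmx A) y i 0) <= c * m ^+ k.
Proof.
case: n A y => [|n] A y m0 Am; first by exists 0 => // k [].
have normE (z : R[i]) : `|z| = (normc z)%:C%C by [].
have hm z : eigenvalue A z -> `|z| < m%:C%C.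
  by move=> ez; rewrite normE ltcR (le_lt_trans (eigenvalue_le_spectral_radius ez)).
have [c c0 hc] := growth_bounded_eigen y hm.
(* In the order of [R[i]], being nonnegative includes being real. *)
have cE : c = (complex.Re c)%:C%C by move: c0; case: {hc}c => a b; rewrite lecE /= => /andP[/eqP-> _].
exists (complex.Re c); first by rewrite -lecR -cE.
move=> k i; have := hc k i.
by rewrite normE cE -rmorphXn -rmorphM lecR.
Qed.

#[local] Arguments child : simpl never.

Local Opaque Sinf Se.

(** * Counting triangles whose type is neither zero nor full *)

Section Counting.

Fixpoint count_active (k : nat) (s : nbtype) : nat :=
  if k is k'.+1 then (count_active k' (child false s) + count_active k' (child true s))%N
  else s \notin Sa.

Lemma count_active_Sa k s : s \in Sa -> count_active k s = 0%N.
Proof.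
elim: k s => [|k IHk] s sa /=; first by rewrite sa.
by rewrite !IHk // child_Sa.
Qed.

Lemma count_active_Se k s : s \in Se -> (0 < count_active k s)%N.
Proof.
elim: k s => [|k IHk] s se /=; first by move: se; rewrite mem_SeE => /and3P[_ ->].
by have [[] /IHk] := Se_has_child se; rewrite addn_gt0 => ->; rewrite ?orbT.
Qed.

Lemma count_active_pieces k m p : unit_elem p ->
  count (fun q => elem_type (k + m) q \notin Sa) (pieces k p)
  = count_active k (elem_type m p).
Proof.
elim: k m p => [|k IHk] m p up; first by rewrite /= addn0.
rewrite (permP (pieces_cat k p)) count_cat addSnnS !IHk ?unit_half //.
by rewrite !elem_type_half.
Qed.

Context {R : realType}.
Local Notation M := (map_mx (fun n : nat => n%:R : R[i]) child_matrix).

(** Extension by zero from S_e to all types, so that a row of C becomes a sum over the two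
    children. *)
Definition extend (V : nzRingType) (w : 'I_#|Se| -> V) (s : nbtype) : V :=
  \sum_j (s == enum_val j)%:R * w j.

Lemma extend_enum_val V w i : @extend V w (enum_val i) = w i.
Proof.
rewrite /extend (bigD1 i) //= eqxx mul1r big1 ?addr0 // => j ji.
by rewrite (inj_eq enum_val_inj) eq_sym (negPf ji) mul0r.
Qed.

Lemma extend_out V w s : s \notin Se -> @extend V w s = 0.
Proof.
move=> sn; rewrite /extend big1 // => j _; case: eqP => [sE|_]; last by rewrite mul0r.
by move: sn; rewrite sE enum_valP.
Qed.

Lemma child_matrixE (w : 'cV[R[i]]_#|Se|) i :
  (M *m w) i 0 = extend (fun j => w j 0) (child false (enum_val i))
               + extend (fun j => w j 0) (child true (enum_val i)).
Proof.
rewrite mxE -big_split /=; apply: eq_bigr => j _.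
by rewrite !mxE natrD mulrDl.
Qed.

Lemma Se_index s : s \in Se -> exists i : 'I_#|Se|, s = enum_val i.
Proof. by move=> se; exists (enum_rank_in se s); rewrite enum_rankK_in. Qed.

(** Children outside S_e are in S_a and count for nothing, so C alone governs the counting. *)
Lemma count_active_matrix k (i : 'I_#|Se|) :
  iter k (mulmx M) (const_mx 1 : 'cV[R[i]]_#|Se|) i 0 = (count_active k (enum_val i))%:R.
Proof.
elim: k i => [|k IHk] i.
  by have := enum_valP i; rewrite mxE /= mem_SeE => /and3P[_ -> _].
rewrite [iter _ _ _]/= child_matrixE [count_active _ _]/= natrD.
have E s : (s \in Se) || (s \in Sa) ->
    extend (fun j => iter k (mulmx M) (const_mx 1 : 'cV[R[i]]_#|Se|) j 0) s = (count_active k s)%:R.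
  case: (boolP (s \in Se)) => /= [/Se_index[j ->] _|sn sa].
    by rewrite extend_enum_val IHk.
  by rewrite extend_out // count_active_Sa.
by rewrite !E // child_Se // enum_valP.
Qed.

Lemma count_active_growth_Se (m : R) : 0 < m -> spectral_radius M < m ->
  exists2 c, 0 <= c & forall k s, s \in Se -> (count_active k s)%:R <= c * m ^+ k.
Proof.
move=> m0 Mm; have [c c0 hc] := growth_spectral_radius (const_mx 1 : 'cV[R[i]]_#|Se|) m0 Mm.
exists c => // k s /Se_index[i ->]; have := hc k i.
have -> : iter k (mulmx M) (const_mx 1 : 'cV[R[i]]_#|Se|) i 0 = ((count_active k (enum_val i))%:R)%:C%C.
  by rewrite count_active_matrix rmorph_nat.
by rewrite /normc /= expr0n addr0 sqrtr_sqr ger0_norm.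
Qed.

(** A type of S_e has descendants in S_e at every level, so its counts cannot tend to 0. *)
Lemma spectral_radius_child_ge1 : 1 <= spectral_radius M.
Proof.
rewrite leNgt; apply/negP => lt1.
pose m := (Num.max 0 (spectral_radius M) + 1) / 2.
have mx1 : Num.max 0 (spectral_radius M) < 1 by rewrite gt_max ltr01.
have mx0 : 0 <= Num.max 0 (spectral_radius M) by rewrite le_max lexx.
have mxM : spectral_radius M <= Num.max 0 (spectral_radius M).
  by rewrite le_max lexx orbT.
have m0 : 0 < m by rewrite /m; lra.
have m1 : m < 1 by rewrite /m; lra.
have Mm : spectral_radius M < m.
  by apply: le_lt_trans mxM _; rewrite /m; move: mx1; set a := Num.max _ _ => ?; lra.
have [c c0 hc] := count_active_growth_Se m0 Mm.
have [s sSe] := Se_neq0.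
have cvg0 : (fun k => c * m ^+ k) @ \oo --> c * 0.
  by apply: cvgZr; apply: cvg_expr; rewrite ger0_norm // ltW.
have : \forall k \near \oo, c * m ^+ k < 1.
  by apply: cvgr_lt cvg0 _ _; rewrite mulr0.
move=> [k _ /(_ k (leqnn k)) /= lt].
have := le_lt_trans (hc k s sSe) lt.
by rewrite ltNge ler1n count_active_Se.
Qed.

(** At least one child is outside S_t and is controlled by C; the other one falls under the
    induction hypothesis. The constant is chosen so that [c' + c <= c' * m], which is possible since
    [1 < m]. *)
Lemma count_active_growth_Sinf (m : R) : 1 < m -> spectral_radius M < m ->
  exists2 c, 0 <= c & forall k s, s \in Sinf -> (count_active k s)%:R <= c * m ^+ k.
Proof.
move=> m1 Mm; have m0 : 0 < m by apply: lt_trans m1.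
have [c c0 hc] := count_active_growth_Se m0 Mm.
pose c' := 1 + 2 * c + c / (m - 1).
have cm : 0 <= c / (m - 1) by rewrite divr_ge0 // subr_ge0 ltW.
have c'0 : 0 <= c' by rewrite /c'; lra.
have mk k : 1 <= m ^+ k by rewrite exprn_ege1 // ltW.
have hea k s : (s \in Se) || (s \in Sa) -> (count_active k s)%:R <= c * m ^+ k.
  case/orP => [/hc //|/count_active_Sa ->].
  by rewrite mulr_ge0 ?exprn_ge0 // ltW.
have c'1 : 1 <= c' by rewrite /c'; lra.
have grow : c' + c <= c' * m.
  have : c = c / (m - 1) * (m - 1) by rewrite divfK // subr_eq0 gt_eqF.
  rewrite /c'; nra.
have m0k k : 0 <= m ^+ k by rewrite exprn_ge0 // ltW.
exists c' => //; elim=> [|k IHk] s sS.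
  rewrite expr0 mulr1; apply: le_trans c'1.
  by rewrite [count_active _ _]/= lern1 leq_b1.
have key j : child j s \notin St ->
    (count_active k (child j s))%:R <= c * m ^+ k.
  move=> nt; apply: hea; have := Sinf_cases (child_Sinf j sS).
  by case=> [->|->|]; rewrite ?orbT // (negPf nt).
have fin (a b : R) : a <= c' * m ^+ k -> b <= c * m ^+ k -> a + b <= c' * m ^+ k.+1.
  move=> ha hb; apply: le_trans (lerD ha hb) _.
  by rewrite exprS mulrA -mulrDl ler_wpM2r.
rewrite /= natrD.
have IH j := IHk _ (child_Sinf j sS).
case: (Sinf_cases sS) => st.
- apply: fin; first exact: IH.
  by apply: hea; rewrite child_Se.
- by apply: fin; [exact: IH | apply: hea; rewrite child_Sa // orbT].
- case/orP: (St_child sS st) => nt; last by apply: fin; [exact: IH | exact: (key true)].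
  by rewrite addrC; apply: fin; [exact: IH | exact: (key false)].
Qed.

(** For the types of the levels before 19, by induction on the number of levels left before
    [Sinf]. *)
Lemma count_active_growth (m : R) j n s : 1 < m -> spectral_radius M < m ->
  (j + n = 19)%N -> s \in types_at n ->
  exists2 c, 0 <= c & forall k, (count_active k s)%:R <= c * m ^+ k.
Proof.
move=> m1 Mm; elim: j n s => [|j IHj] n s jn.
  move: jn; rewrite add0n => ->; rewrite -Sinf_types_at => sS.
  have [c c0 hc] := count_active_growth_Sinf m1 Mm.
  by exists c => [//|k]; exact: hc sS.
move=> sS; have hch i := types_at_child i sS.
rewrite addSnnS in jn.
have [c0 c00 h0] := IHj _ _ jn (hch false).
have [c1 c10 h1] := IHj _ _ jn (hch true).
have m0 : 0 < m by apply: lt_trans m1.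
have c2 : 1 <= 1 + c0 + c1 by rewrite -addrA lerDl addr_ge0.
have c3 : c0 + c1 <= (1 + c0 + c1) * m.
  apply: le_trans (_ : 1 + c0 + c1 <= _); first by rewrite -addrA lerDr.
  by rewrite ler_peMr ?(ltW m1) // (le_trans ler01).
exists (1 + c0 + c1); first by rewrite (le_trans ler01).
case=> [|k].
  rewrite expr0 mulr1; apply: le_trans c2.
  by rewrite [count_active _ _]/= lern1 leq_b1.
have mk : 0 < m ^+ k by rewrite exprn_gt0.
rewrite [count_active _ _]/= natrD exprS mulrA.
apply: le_trans (lerD (h0 k) (h1 k)) _.
by rewrite -mulrDl ler_wpM2r ?(ltW mk).
Qed.

End Counting.


(** * Hausdorff measure of the boundary *)

Section HausdorffMeasure.
Context {R : realType} {T : Type} (dist : T -> T -> R).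
Hypothesis dist_refl : forall x, dist x x = 0.
Local Open Scope ereal_scope.

Lemma diam_ge0 (U : set T) : U !=set0 -> 0 <= diam dist U.
Proof.
move=> [x Ux]; apply: ereal_sup_ubound; exists (x, x) => //=.
by rewrite dist_refl.
Qed.

Lemma dist_le_diam (U : set T) x y : U x -> U y -> (dist x y)%:E <= diam dist U.
Proof. by move=> Ux Uy; apply: ereal_sup_ubound; exists (x, y). Qed.

Lemma diam_le (U : set T) (d : R) :
  (forall x y, U x -> U y -> (dist x y <= d)%R) -> diam dist U <= d%:E.
Proof.
move=> h; apply: ge_ereal_sup => _ [[x y] [/= Ux Uy] <-].
by rewrite lee_fin h.
Qed.

Lemma weight_ge0 s (U : set T) : 0 <= weight dist s U.
Proof. by rewrite /weight; case: ifP => // _; exact: poweR_ge0. Qed.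

Lemma weight_le s (U : set T) (d : R) : (0 <= s)%R -> (0 <= d)%R ->
  diam dist U <= d%:E -> weight dist s U <= (d `^ s)%:E.
Proof.
move=> s0 d0 Ud; rewrite /weight; case: ifP => [_|/negbT/set0P U0].
  by rewrite lee_fin powR_ge0.
rewrite -poweR_EFin; apply: gt0_ler_poweR => //.
  by rewrite in_itv /= diam_ge0 // leey.
by rewrite in_itv /= lee_fin d0 leey.
Qed.

Lemma hausdorff_premeasure_ge0 s d A : 0 <= hausdorff_premeasure dist s d A.
Proof.
apply: le_ereal_inf_tmp => _ [U _ <-]; apply: nneseries_ge0 => *.
exact: weight_ge0.
Qed.

(** Finite covers suffice: they are padded with empty sets, of weight 0 and diameter -oo. *)
Lemma hausdorff_measure_eq0 s A :
  (forall d e : R, (0 < d)%R -> (0 < e)%R -> exists L : seq (set T),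
     [/\ A `<=` \bigcup_(i in [set i | (i < size L)%N]) nth set0 L i,
         forall i, diam dist (nth set0 L i) <= d%:E
       & \sum_(U <- L) weight dist s U <= e%:E]) ->
  hausdorff_measure dist s A = 0.
Proof.
move=> h; apply/eqP; rewrite eq_le; apply/andP; split; last first.
  apply: le_trans (hausdorff_premeasure_ge0 s 1 A) _.
  by apply: ereal_sup_ubound; exists 1%R => //=.
apply: ge_ereal_sup => _ [d /= d0 <-].
apply/lee_addgt0Pr => e e0; rewrite add0e.
have [L [cov small sum]] := h d e d0 e0.
apply: le_trans sum; apply: ge_ereal_inf.
exists (\sum_(0 <= i <oo) weight dist s (nth set0 L i)).
  exists (nth set0 L) => //; split=> // x /cov[i _ ?]; by exists i.
rewrite (nneseries_split _ (size L)) => [|k _]; last exact: weight_ge0.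
rewrite add0n eseries0 ?adde0 => [|i Li _]; last first.
  by rewrite nth_default // /weight eqxx.
by rewrite (big_nth set0).
Qed.

End HausdorffMeasure.

(** * Upper bound *)

Section Upper.
Context {R : realType}.
Local Notation M := (map_mx (fun n : nat => n%:R : R[i]) child_matrix).
Local Notation rt2 := (Num.sqrt 2 : R).

Lemma rt2_gt0 : 0 < rt2. Proof. by rewrite sqrtr_gt0. Qed.

Lemma rt2_sq : rt2 ^+ 2 = 2. Proof. by rewrite sqr_sqrtr. Qed.

Lemma rt2_gt1 : 1 < rt2.
Proof. by rewrite -[X in X < _]sqrtr1 ltr_sqrt // ltr1n. Qed.

Lemma euclidean_dist_le (x y : R * R) k c : 0 <= c -> 
  (euclidean_dist x y <= c / rt2 ^+ k) = (dist2 x y <= c ^+ 2 / 2 ^+ k).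
Proof.
move=> c0; have d0 : 0 <= c / rt2 ^+ k by rewrite divr_ge0 // exprn_ge0 // ltW // rt2_gt0.
rewrite -[LHS](ler_pXn2r (n := 2)) ?nnegrE ?sqrtr_ge0 // sqr_sqrtr ?dist2_ge0 //.
by rewrite exprMn exprVn -exprM mulnC exprM rt2_sq.
Qed.

Lemma euclidean_dist_refl (x : R * R) : euclidean_dist x x = 0.
Proof. by rewrite /euclidean_dist !subrr expr0n addr0 sqrtr0. Qed.

(** A boundary point may lie slightly outside the triangle that [boundary_cover] assigns to it. *)
Definition fat_tri k p : set (R * R) :=
  [set x | exists2 y, tri k p y & dist2 x y < 1 / 2 ^+ k].

Lemma diam_fat_tri k p : unit_elem p ->
  (diam euclidean_dist (fat_tri k p) <= (4 / rt2 ^+ k)%:E)%E.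
Proof.
move=> up; apply: diam_le => x x' [_ [y yT <-] xy] [_ [y' yT' <-] xy'].
rewrite euclidean_dist_le //.
have h1 := dist2_triangle x (lvl k p y) x'.
have h2 := dist2_triangle (lvl k p y) (lvl k p y') x'.
rewrite dist2_lvl // in h2; rewrite (dist2C x') in xy'.
have h3 : dist2 y y' / 2 ^+ k <= 1 / 2 ^+ k.
  by rewrite ler_pM2r ?invr_gt0 ?exprn_gt0 // triangle_dist2.
(* Two uses of [dist2_triangle] give 2 (1 + 2 (1 + 1)) = 10, below 16. *)
have -> : 4 ^+ 2 / 2 ^+ k = 16 * (1 / 2 ^+ k) :> R by rewrite mul1r; congr (_ * _); ring.
have h4 : 0 < 1 / 2 ^+ k :> R by rewrite divr_gt0 ?exprn_gt0.
clear -xy xy' h1 h2 h3 h4; move: xy xy' h1 h2 h3 h4.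
set a := dist2 x _; set b := dist2 _ x'; set b' := dist2 _ x'.
set e := 1 / _; set f := _ / _; set g := dist2 x x'; lra.
Qed.

Definition active k : seq elem :=
  [seq p <- flatten [seq pieces k p | p <- star] | elem_type k p \notin Sa].

(** Type 0 is passed on to all descendants, so the ancestor of level 0 has nonzero type and lies in
    the star. *)
Lemma active_cover (K : set (R * R)) k x : is_levy_dragon K -> boundary K x ->
  exists2 p, p \in active k & fat_tri k p x.
Proof.
move=> dK /(boundary_cover dK k)[p [up ap xp]]; exists p => //.
rewrite mem_filter ap; apply/flattenP.
have [q [w [uq sw pE]]] := refine_surj k up.
exists (pieces k q); last by rewrite pE -sw mem_pieces_refine.
apply/map_f/(elem_type0_neq0 uq) => q0.
move: ap; rewrite pE -sw -[size w]addn0 elem_type_refine // q0.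
suff -> : descend zero_type w = zero_type by move/SaP; case; left.
by elim: w {sw pE} => //= j w IHw; rewrite child_zero.
Qed.

Lemma unit_active k p : p \in active k -> unit_elem p.
Proof.
rewrite mem_filter => /andP[_ /flattenP[_ /mapP[q qs ->]]].
by apply: unit_pieces; exact: unit_star.
Qed.

Lemma size_active (m : R) : 1 < m -> spectral_radius M < m ->
  exists2 c, 0 <= c & forall k, (size (active k))%:R <= c * m ^+ k.
Proof.
move=> m1 Mm.
have E k : size (active k) = (\sum_(p <- star) count_active k (elem_type 0 p))%N.
  rewrite /active size_filter count_flatten -map_comp sumnE big_map.
  by rewrite !big_seq; apply: eq_bigr => p ps /=;
     rewrite -(count_active_pieces k 0) ?unit_star // addn0.
have : forall s : seq elem, {subset s <= (star : seq elem)} -> exists2 c, 0 <= c &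
    forall k, (\sum_(p <- s) count_active k (elem_type 0 p))%:R <= c * m ^+ k.
  elim=> [|p s IHs] ss; first by exists 0 => // k; rewrite big_nil mul0r.
  have [|c c0 hc] := IHs; first by move=> q qs; apply: ss; rewrite inE qs orbT.
  have ps : p \in (star : seq elem) by apply: ss; rewrite inE eqxx.
  have [c1 c10 hc1] := count_active_growth m1 Mm (addn0 19) (star_elem_type ps).
  exists (c1 + c); first exact: addr_ge0.
  by move=> k; rewrite big_cons natrD mulrDl lerD.
move=> /(_ star)[//|c c0 hc]; exists c => // k; by rewrite E.
Qed.

(** With [m] strictly between the spectral radius and [r = rt2 ^ s], the cover by fat triangles of
    level [k] has total weight at most [c 4^s (m / r)^k], which tends to 0. *)
Lemma boundary_hausdorff_measure0 (K : set (R * R)) (s : R) :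
  is_levy_dragon K -> 0 <= s -> ln (spectral_radius M) / ln rt2 < s ->
  hausdorff_measure euclidean_dist s (boundary K) = 0%E.
Proof.
move=> dK s0 ls; pose r : R := rt2 `^ s.
have lnrt : 0 < ln rt2 by rewrite ln_gt0 // rt2_gt1.
have l1 := @spectral_radius_child_ge1 R.
set l := spectral_radius M in ls l1.
have lr : l < r.
  rewrite -ltr_ln ?posrE ?powR_gt0 ?rt2_gt0 ?(lt_le_trans ltr01) //.
  by rewrite ln_powR -ltr_pdivrMr.
pose m := (l + r) / 2.
have [lm mr] : l < m /\ m < r by rewrite /m; split; lra.
have m1 : 1 < m by apply: le_lt_trans lm.
have [c c0 hc] := size_active m1 lm.
have r0 : 0 < r by rewrite powR_gt0 ?rt2_gt0.
apply: hausdorff_measure_eq0 => d e d0 e0.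
have small1 : \forall k \near \oo, 4 * rt2^-1 ^+ k < d.
  have cv : (fun k => 4 * rt2^-1 ^+ k) @ \oo --> (4 * 0 : R).
    apply: cvgZr; apply: cvg_expr.
    by rewrite ger0_norm ?invr_ge0 ?ltW ?rt2_gt0 // invf_lt1 ?rt2_gt0 ?rt2_gt1.
  by apply: cvgr_lt cv _ _; rewrite mulr0.
have small2 : \forall k \near \oo, c * 4 `^ s * (m / r) ^+ k < e.
  have cv : (fun k => c * 4 `^ s * (m / r) ^+ k) @ \oo --> (c * 4 `^ s * 0 : R).
    apply: cvgZr; apply: cvg_expr.
    rewrite ger0_norm; last by rewrite divr_ge0 ?(ltW r0) ?(le_trans ler01 (ltW m1)).
    by rewrite ltr_pdivrMr // mul1r.
  by apply: cvgr_lt cv _ _; rewrite mulr0.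
have [k [k1 k2]] : exists k, 4 * rt2^-1 ^+ k < d /\ c * 4 `^ s * (m / r) ^+ k < e.
  by have [k _ /(_ k (leqnn k)) hk] := filterI small1 small2; exists k.
exists [seq fat_tri k p | p <- active k]; rewrite size_map; split.
- move=> x /(active_cover k dK)[p pa xp].
  exists (index p (active k)); first by rewrite /= index_mem.
  by rewrite (nth_map p) ?index_mem // nth_index.
- move=> i; have [ilt|ige] := ltnP i (size (active k)).
    rewrite (nth_map id_elem) //.
    apply: le_trans (diam_fat_tri k _) _; first by apply: (@unit_active k); exact: mem_nth.
    by rewrite lee_fin -exprVn ltW.
  rewrite nth_default ?size_map //; apply: diam_le => //.
rewrite big_map big_seq.
apply: (@le_trans _ _ (\sum_(p <- active k | p \in active k) ((4 / rt2 ^+ k) `^ s)%:E)%E).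
  apply: lee_sum => p /unit_active up.
  apply: (weight_le euclidean_dist_refl s0 _ (diam_fat_tri k up)).
  by rewrite divr_ge0 // exprn_ge0 // ltW // rt2_gt0.
rewrite -big_seq sumEFin lee_fin big_const_seq count_predT iter_addr_0.
apply: le_trans (ltW k2); rewrite -[X in X <= _]mulr_natl.
have -> : (4 / rt2 ^+ k) `^ s = 4 `^ s * r^-1 ^+ k.
  rewrite powRM ?invr_ge0 ?exprn_ge0 ?ltW ?rt2_gt0 //; congr (_ * _).
  by rewrite -powR_invn ?ltW ?rt2_gt0 // -powRrM mulrC powRrM powR_invn ?exprVn // ltW.
rewrite exprMn exprVn.
have : (size (active k))%:R <= c * m ^+ k by [].
move=> h; have x0 : 0 <= 4 `^ s * r ^- k by rewrite mulr_ge0 ?powR_ge0 // invr_ge0 exprn_ge0 // ltW.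
apply: le_trans (ler_wpM2r x0 h) _.
by rewrite le_eqVlt; apply/orP; left; apply/eqP; ring.
Qed.

End Upper.


(** * Nested compact triangles *)

Lemma nested_compact {T : topologicalType} (A : nat -> set T) :
  hausdorff_space T -> (forall n, compact (A n)) -> (forall n, A n !=set0) ->
  (forall n, A n.+1 `<=` A n) -> exists x, forall n, A n x.
Proof.
move=> hT cA A0 AS.
have mono m n : (m <= n)%N -> A n `<=` A m.
  by move=> /subnK <-; elim: (n - m)%N => // d IHd x /AS/IHd.
have [a aA] : exists a, forall n, A n (a n).
  by have := A0; move=> /choice[a ?]; exists a.
have FA n : (a @ \oo) (A n).
  by exists n => // m /= nm; exact: mono (aA m).
have [x [_ xcl]] := cA 0 (a @ \oo) _ (FA 0).
exists x => n; apply: (compact_closed hT (cA n)) => B xB.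
exact: xcl (FA n) xB.
Qed.

Section TriangleTopology.
Context {R : realType}.

Lemma triangle_compact : compact (@triangle R).
Proof.
have cl : closed (@triangle R).
  move=> x /closureP cx; rewrite /triangle /=.
  split; rewrite leNgt; apply/negP => lt.
  - have [y [y1 y2 y3] /dist2_coord xy] := cx _ (exprn_gt0 2 (ltac:(lra) : 0 < - x.2)).
    by case: xy => *; lra.
  - have [y [y1 y2 y3] /dist2_coord xy] :=
      cx _ (exprn_gt0 2 (ltac:(lra) : 0 < (x.2 - x.1) / 2)).
    by case: xy => *; lra.
  - have [y [y1 y2 y3] /dist2_coord xy] :=
      cx _ (exprn_gt0 2 (ltac:(lra) : 0 < (x.1 + x.2 - 1) / 2)).
    by case: xy => *; lra.
apply: (subclosed_compact cl
  (compact_setX (@segment_compact R 0 1) (@segment_compact R 0 1))).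
by move=> x [? ? ?]; split; rewrite /= in_itv /=; apply/andP; split; lra.
Qed.

Lemma tri_compact k p : unit_elem p -> compact (@tri R k p).
Proof.
move=> up; apply: continuous_compact triangle_compact.
apply: continuous_subspaceT => x A /nbhs_dist2[e e0 sub].
have e1 : 0 < e * 2 ^+ k by rewrite mulr_gt0 ?exprn_gt0.
apply: filterS (dist2_nbhs x e1) => y xy; apply: sub.
by rewrite dist2_lvl // ltr_pdivrMr ?exprn_gt0.
Qed.

End TriangleTopology.

(** * Mass distribution and descent along uncovered triangles *)

Section MassDistribution.
Context {R : realType} (K : set (R * R)) (dragonK : is_levy_dragon K).
Variables (m : R) (v : nbtype -> R) (V : R).
Hypothesis m_gt0 : 0 < m.
Hypothesis v_ge0 : forall s, 0 <= v s.
Hypothesis v_le : forall s, v s <= V.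
Hypothesis v_Se : forall s, 0 < v s -> s \in Se.
Hypothesis v_super : forall s, m * v s <= v (child false s) + v (child true s).

Definition mass k p : R := v (elem_type k p) / m ^+ k.

Lemma mass_ge0 k p : 0 <= mass k p.
Proof. by rewrite divr_ge0 ?exprn_ge0 // ltW. Qed.

Lemma mass_split k p : unit_elem p ->
  mass k p <= mass k.+1 (half_elem false p) + mass k.+1 (half_elem true p).
Proof.
move=> up; rewrite /mass !elem_type_half // -mulrDl.
rewrite ler_pdivlMr ?exprn_gt0 // exprS mulrCA mulrA -mulrA.
by rewrite -[_ / _ * _]mulrA mulVf ?mulr1 // expf_neq0 // gt_eqF.
Qed.

Variables (U : nat -> set (R * R)) (level : nat -> nat).

(* The set [U i] is only tested against triangles of level [level i]. *)
Definition hit i p : bool := `[< tri (level i) p `&` U i !=set0 >].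

(** The value 0 for triangles finer than [level i] keeps this superadditive under bisection. *)
Definition hit_mass i k p : R :=
  if (k <= level i)%N then
    \sum_(q <- pieces (level i - k) p) (hit i q)%:R * mass (level i) q
  else 0.

Lemma hit_mass_ge0 i k p : 0 <= hit_mass i k p.
Proof.
rewrite /hit_mass; case: ifP => // _; apply: sumr_ge0 => q _.
by rewrite mulr_ge0 // mass_ge0.
Qed.

Lemma hit_mass_split i k p :
  hit_mass i k.+1 (half_elem false p) + hit_mass i k.+1 (half_elem true p)
  <= hit_mass i k p.
Proof.
have [lt|ge] := ltnP k (level i); last first.
  by rewrite {1 2}/hit_mass ltnNge ge /= addr0 hit_mass_ge0.
by rewrite /hit_mass lt (ltnW lt) -(subnSK lt) pieces_sum.
Qed.

Local Open Scope ereal_scope.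

Definition total_hit k p : \bar R := \sum_(0 <= i <oo) (hit_mass i k p)%:E.

Lemma total_hit_split k p :
  total_hit k.+1 (half_elem false p) + total_hit k.+1 (half_elem true p)
  <= total_hit k p.
Proof.
rewrite /total_hit -nneseriesD; try by move=> *; rewrite lee_fin hit_mass_ge0.
apply: lee_nneseries => [i _ _|i _]; rewrite -EFinD lee_fin.
  by rewrite addr_ge0 ?hit_mass_ge0.
exact: hit_mass_split.
Qed.

Lemma hit_total_hit i p : hit i p -> (mass (level i) p)%:E <= total_hit (level i) p.
Proof.
move=> hp; apply: (@le_trans _ _ (hit_mass i (level i) p)%:E).
  by rewrite lee_fin /hit_mass leqnn subnn /= big_seq1 hp mul1r.
rewrite /total_hit (nneseriesD1 (n := i)) //; last first.
  by move=> k _; rewrite lee_fin hit_mass_ge0.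
rewrite leeDl // nneseries_ge0 // => k _ _.
by rewrite lee_fin hit_mass_ge0.
Qed.

(** The invariant of the descent. It passes to one of the halves, because mass is subadditive and
    hit mass superadditive under bisection. *)
Definition light k p := unit_elem p /\ total_hit k p < (mass k p)%:E.

Lemma light_half k p : light k p -> exists j, light k.+1 (half_elem j p).
Proof.
move=> [up lt]; apply: contrapT => none.
have heavy j : (mass k.+1 (half_elem j p))%:E <= total_hit k.+1 (half_elem j p).
  rewrite leNgt; apply/negP => lj; apply: none; exists j.
  by split => //; rewrite unit_half.
have := le_lt_trans (total_hit_split k p) lt; rewrite ltNge => /negP; apply.
apply: le_trans (leeD (heavy false) (heavy true)).
by rewrite -EFinD lee_fin mass_split.
Qed.

Lemma light_Se k p : light k p -> elem_type k p \in Se.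
Proof.
move=> [_ lt]; apply: v_Se; rewrite lt_neqAle v_ge0 andbT eq_sym.
apply: contraTneq lt => v0; rewrite -leNgt /mass v0 mul0r.
by apply: nneseries_ge0 => *; rewrite lee_fin hit_mass_ge0.
Qed.

Local Open Scope ring_scope.

(** Types of S_e are nonzero, which puts [x] in K; each has a descendant of type 0, which puts
    points outside K in every triangle of the path. *)
Lemma Se_path_boundary (k0 : nat) (q : nat -> elem) x :
  (forall n, [/\ unit_elem (q n), elem_type (k0 + n) (q n) \in Se
               & tri (k0 + n) (q n) x]) -> boundary K x.
Proof.
move=> hq.
have Kx : K x.
  apply: (@nonzero_types_dragon _ _ dragonK x k0) => k kk.
  have [uq se xq] := hq (k - k0)%N; rewrite subnKC // in se xq.
  exists (q (k - k0)%N); split=> // z.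
  by move: se; rewrite z mem_SeE => /and3P[_ /SaP[]]; left.
apply/(boundaryP _ (dragon_closed dragonK)); split=> // e e0.
have [k1 hk1] := div_exp2_small 1 e0.
have [uq se [t tT xE]] := hq k1.
have [w wz] := Se_reach0 se.
have [y yw nKy] : exists2 y, tri (size w + (k0 + k1)) (refine (q k1) w) y & ~ K y.
  by apply: zero_type_dragon; rewrite ?unit_refine // elem_type_refine.
exists y => //; have [t' tT' yE] := tri_refine yw.
apply: le_lt_trans (hk1 (k0 + k1)%N (leq_addl _ _)).
rewrite -xE -yE dist2_lvl // ler_pM2r ?invr_gt0 ?exprn_gt0 //.
exact: triangle_dist2.
Qed.

(** The descent from [p0] shrinks to a boundary point. If [U i] contained it, the triangle of level
    [level i] on the path would be hit, hence not light; the path crosses that level because it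
    starts no later. *)
Lemma light_uncovered k0 p0 : light k0 p0 -> (forall i, (k0 <= level i)%N) ->
  ~ (boundary K `<=` \bigcup_i U i).
Proof.
move=> l0 kl cov.
pose next k p := if `[< light k.+1 (half_elem false p) >] then half_elem false p
                 else half_elem true p.
have lnext k p : light k p -> light k.+1 (next k p).
  move=> /light_half[j lj]; rewrite /next; case: asboolP => // nl.
  by case: j lj.
have nextsub k p : @tri R k.+1 (next k p) `<=` tri k p.
  by rewrite /next; case: ifP => _; exact: tri_half.
pose q := fix q n := if n is n'.+1 then next (k0 + n')%N (q n') else p0.
have lq n : light (k0 + n) (q n).
  elim: n => [|n IHn] /=; first by rewrite addn0.
  by rewrite addnS; exact: lnext.
have [x xq] : exists x, forall n, @tri R (k0 + n) (q n) x.
  apply: nested_compact.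
  - exact: norm_hausdorff.
  - by move=> n; apply: tri_compact; case: (lq n).
  - move=> n; exists (lvl (k0 + n) (q n) (0, 0)); exists (0, 0) => //.
    exact: triangle0.
  - by move=> n /=; rewrite addnS; exact: nextsub.
have bx : boundary K x.
  apply: (@Se_path_boundary k0 q) => n; split=> //; first by case: (lq n).
  exact: light_Se.
have [i _ Ui] := cov x bx.
have [_] := lq (level i - k0)%N; rewrite subnKC //.
rewrite ltNge hit_total_hit //; apply/asboolP; exists x; split=> //.
by have := xq (level i - k0)%N; rewrite subnKC.
Qed.

(** All triangles hit by so small a set are among the 15 neighbours of any one of them. *)
Lemma hit_mass_le i k p : unit_elem p ->
  (forall x y, U i x -> U i y -> dist2 x y < (1/10) ^+ 2 / 2 ^+ level i) ->
  hit_mass i k p <= 15 * V / m ^+ level i.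
Proof.
move=> up small; have V0 : 0 <= V by apply: le_trans (v_le zero_type).
have mm : 0 <= (m ^+ level i)^-1 by rewrite invr_ge0 exprn_ge0 // ltW.
rewrite /hit_mass; case: ifP => _; last by rewrite mulr_ge0 ?mulr_ge0.
set P := pieces _ _.
apply: (@le_trans _ _ (\sum_(q <- P) (hit i q)%:R * (V / m ^+ level i))).
  by apply: ler_sum => q _; rewrite ler_wpM2l // ler_wpM2r.
rewrite -mulr_suml -mulrA ler_wpM2r ?mulr_ge0 // -natr_sum ler_nat.
have -> : (\sum_(q <- P) hit i q)%N = size [seq q <- P | hit i q].
  by rewrite size_filter -sum1_count [RHS]big_mkcond; apply: eq_bigr => q _; case: hit.
case E : [seq q <- P | hit i q] => [|q0 s] //; rewrite -E.
have inP q : q \in [seq q <- P | hit i q] -> unit_elem q /\ hit i q.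
  by rewrite mem_filter => /andP[hq qP]; split=> //; exact: unit_pieces qP.
have [u0 /asboolP[x [[t tT xE] Ux]]] : unit_elem q0 /\ hit i q0.
  by apply: inP; rewrite E inE eqxx.
rewrite -[15%N]/(size [seq mul_elem q0 h | h <- star]).
apply: uniq_leq_size; first by rewrite filter_uniq // uniq_pieces.
move=> q /inP[uq /asboolP[y [[t' tT' yE] Uy]]].
apply/mapP; exists (mul_elem (inv_elem q0) q).
  apply: star_near (unit_mul (unit_inv u0) uq) tT tT' _.
  rewrite -(ltr_pM2r (x := (2 ^+ level i)^-1)) ?invr_gt0 ?exprn_gt0 //.
  by rewrite -dist2_pull // xE yE small.
by rewrite -mul_elemA mul_inv // id_mul.
Qed.

End MassDistribution.


(** * Lower bound *)

Section Lower.
Context {R : realType}.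
Local Notation M := (map_mx (fun n : nat => n%:R : R[i]) child_matrix).
Local Notation rt2 := (Num.sqrt 2 : R).

(* The moduli of a right eigenvector: the triangle inequality replaces the
   Perron-Frobenius theorem. *)
Lemma subinvariant_vector (z : R[i]) : eigenvalue M z -> exists (v : nbtype -> R) (V : R),
  [/\ forall s, 0 <= v s, forall s, v s <= V,
      forall s, 0 < v s -> s \in Se,
      forall s, normc z * v s <= v (child false s) + v (child true s)
    & exists s, 0 < v s].
Proof.
move=> /eigenvalue_super[w [w0 Mw]].
pose v := extend (fun j => normc (w j 0)).
have vE i : v (enum_val i) = normc (w i 0) by rewrite /v extend_enum_val.
have v0 s : 0 <= v s.
  case: (boolP (s \in Se)) => [/Se_index[i ->]|sn]; first by rewrite vE normc_ge0.
  by rewrite /v extend_out.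
exists v, (\sum_(s : nbtype) v s); split=> //.
- by move=> s; rewrite (bigD1 s) //= lerDl sumr_ge0.
- move=> s; case: (boolP (s \in Se)) => // sn.
  by rewrite /v extend_out // ltxx.
- move=> s; case: (boolP (s \in Se)) => [/Se_index[i ->]|sn]; last first.
    by rewrite {1}/v extend_out // mulr0 addr_ge0.
  have ext s' : normc (extend (fun j => w j 0) s') = v s'.
    case: (boolP (s' \in Se)) => [/Se_index[j ->]|sn]; first by rewrite vE extend_enum_val.
    by rewrite /v !extend_out // ComplexField.Normc.normc0.
  have := congr1 (fun x : 'cV[R[i]]_#|Se| => x i 0) Mw.
  rewrite /= child_matrixE mxE => e.
  by rewrite vE -ComplexField.Normc.normcM -e -!ext le_normcD.
- have [i wi] : exists i, w i 0 != 0.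
    apply: contrapT => none; move/eqP: w0; apply; apply/matrixP => i j.
    by rewrite mxE ord1; apply/eqP/negPn/negP => wi; apply: none; exists i.
  exists (enum_val i); rewrite lt_neqAle v0 andbT eq_sym vE.
  by apply: contra wi => /eqP/ComplexField.Normc.eq0_normc ->.
Qed.

(** Chooses the level at which a covering set is tested, the scale of its triangles being comparable
    to its diameter. A set of diameter 0 has no such scale: it is tested at a level so fine that [e]
    alone pays for it. *)
Lemma weight_level (s m B e : R) (U : set (R * R)) : 0 <= s -> 0 <= B ->
  1 < m -> rt2 `^ s <= m -> 0 < e ->
  (diam euclidean_dist U <= ((1 / 20) / rt2 ^+ 19)%:E)%E ->
  exists k, [/\ (19 <= k)%N,
    forall x y, U x -> U y -> dist2 x y < (1/10) ^+ 2 / 2 ^+ k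
  & U !=set0 -> ((B / m ^+ k)%:E <=
       (B * (10 * rt2) `^ s)%:E * weight euclidean_dist s U + e%:E)%E].
Proof.
move=> s0 B0 m1 rm e0 dU.
have m0 : 0 < m by apply: lt_trans m1.
have [U0|U0] := pselect (U !=set0); last first.
  exists 19%N; split=> // x y Ux; by case: U0; exists x.
have rt0 k : 0 < rt2 ^+ k :> R by rewrite exprn_gt0 ?rt2_gt0.
have A0 : 0 <= B * (10 * rt2) `^ s by rewrite mulr_ge0 ?powR_ge0.
have [d [dE d0]] : exists d : R, diam euclidean_dist U = d%:E /\ 0 <= d.
  have := diam_ge0 (@euclidean_dist_refl R) U0; move: dU.
  by case: (diam _ _) => // d _ ?; exists d.
have dist_d x y : U x -> U y -> dist2 x y <= d ^+ 2.
  move=> Ux Uy; have := dist_le_diam euclidean_dist Ux Uy.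
  rewrite dE lee_fin -[d]divr1 -(expr0 rt2) euclidean_dist_le //.
  by rewrite !expr0 !divr1.
have wE : weight euclidean_dist s U = (d `^ s)%:E.
  by rewrite /weight ifF ?dE ?poweR_EFin //; apply/negbTE/set0P.
have w0 : (0 <= (B * (10 * rt2) `^ s)%:E * weight euclidean_dist s U)%E.
  by rewrite mule_ge0 // weight_ge0.
have sq k : d < (1 / 10) / rt2 ^+ k -> d ^+ 2 < (1/10) ^+ 2 / 2 ^+ k.
  move=> lt; have -> : (1/10) ^+ 2 / 2 ^+ k = ((1 / 10) / rt2 ^+ k) ^+ 2 :> R.
    by rewrite [RHS]exprMn exprVn -[in RHS]exprM mulnC exprM rt2_sq.
  by rewrite ltr_pXn2r ?nnegrE // divr_ge0 // ltW.
have d19 : d < (1 / 10) / rt2 ^+ 19.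
  move: dU; rewrite dE lee_fin => /le_lt_trans; apply.
  by rewrite ltr_pM2r ?invr_gt0 //; lra.
have [dz|dn] := eqVneq d 0.
  have [k [k19 hk]] : exists k, (19 <= k)%N /\ B / m ^+ k < e.
    have cv : (fun k => B * m^-1 ^+ k) @ \oo --> (B * 0 : R).
      apply: cvgZr; apply: cvg_expr.
      by rewrite ger0_norm ?invr_ge0 ?ltW // invf_lt1.
    have : \forall k \near \oo, B * m^-1 ^+ k < e by apply: cvgr_lt cv _ _; rewrite mulr0.
    move=> [k0 _ hk0]; exists (maxn 19 k0); rewrite leq_maxl; split=> //.
    by rewrite -exprVn; apply: (hk0 (maxn 19 k0)); rewrite /= leq_maxr.
  exists k; split=> //.
    move=> x y Ux Uy; apply: le_lt_trans (dist_d x y Ux Uy) (sq k _).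
    by rewrite dz divr_gt0.
  by move=> _; apply: (@le_trans _ _ e%:E); rewrite ?leeDr // lee_fin ltW.
have {d0 dn}d0 : 0 < d by rewrite lt_neqAle eq_sym dn.
have [k0 hk0] : exists k, ~~ (d < (1 / 10) / rt2 ^+ k).
  have cv : (fun k => (1/10) * rt2^-1 ^+ k) @ \oo --> ((1/10) * 0 : R).
    apply: cvgZr; apply: cvg_expr.
    by rewrite ger0_norm ?invr_ge0 ?ltW ?rt2_gt0 // invf_lt1 ?rt2_gt0 ?rt2_gt1.
  have : \forall k \near \oo, (1/10) * rt2^-1 ^+ k < d by apply: cvgr_lt cv _ _; rewrite mulr0.
  move=> [k0 _ hk0]; exists k0; rewrite -leNgt ltW //.
  by rewrite -exprVn; apply: (hk0 k0 (leqnn _)).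
have exk : exists k, ~~ (d < (1 / 10) / rt2 ^+ k) by exists k0.
have big j : ~~ (d < (1 / 10) / rt2 ^+ j) -> (19 < j)%N.
  rewrite ltnNge; apply: contra => j19; apply: lt_le_trans d19 _.
  rewrite ler_pM2l ?divr_gt0 // lef_pV2 ?posrE //.
  by rewrite ler_weXn2l // ltW // rt2_gt1.
(* The least failing index is k + 1 > 19: the diameter is below the threshold at [k] and not at k +
   1. *)
case: (ex_minnP exk) => -[|k] hk kmin; first by have := big _ hk.
have dk : d < (1 / 10) / rt2 ^+ k.
  by apply/negPn/negP => /kmin; rewrite ltnn.
exists k; split.
- exact: big hk.
- by move=> x y Ux Uy; apply: le_lt_trans (dist_d x y Ux Uy) (sq k dk).
move=> _; rewrite wE -EFinM -EFinD lee_fin.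
apply: le_trans (_ : _ <= B * (10 * rt2) `^ s * d `^ s) _; last by rewrite lerDl ltW.
rewrite -mulrA; apply: ler_wpM2l => //.
rewrite -powRM; [|by rewrite mulr_ge0 // ltW // rt2_gt0|exact: ltW].
(* The factor [10 * rt2] comes from [d] being at least (1/10) / rt2^(k+1), whence rt2^(-k) is at
   most 10 rt2 d. *)
apply: (@le_trans _ _ ((rt2 `^ s) ^- k)).
  by rewrite lef_pV2 ?posrE ?exprn_gt0 ?powR_gt0 ?rt2_gt0 // lerXn2r ?nnegrE ?powR_ge0 // ltW.
have -> : (rt2 `^ s) ^- k = (rt2 ^- k) `^ s.
  by rewrite -powR_invn ?powR_ge0 // -powRrM mulrC powRrM powR_invn // ltW // rt2_gt0.
apply: ge0_ler_powR => //; rewrite ?nnegrE.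
- by rewrite invr_ge0 ltW.
- by rewrite mulr_ge0 ?mulr_ge0 // ltW // rt2_gt0.
have h : 0 <= 10 * rt2 by rewrite mulr_ge0 // ltW // rt2_gt0.
have := ler_wpM2l h (_ : 1 / 10 / rt2 ^+ k.+1 <= d); rewrite leNgt hk => /(_ isT).
apply: le_trans; rewrite le_eqVlt; apply/orP; left; apply/eqP.
rewrite exprS invfM; field.
by rewrite gt_eqF ?rt2_gt0 // gt_eqF.
Qed.

(** Measure zero would give a cover so cheap that a triangle of level 19 and positive mass is light,
    against [light_uncovered]. *)
Lemma boundary_hausdorff_measure_neq0 (K : set (R * R)) (s : R) :
  is_levy_dragon K -> 0 <= s -> s < ln (spectral_radius M) / ln rt2 ->
  hausdorff_measure euclidean_dist s (boundary K) <> 0%E.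
Proof.
move=> dK s0 ls Hz.
have lnrt : 0 < ln rt2 by rewrite ln_gt0 // rt2_gt1.
have l1 := @spectral_radius_child_ge1 R.
have rl : rt2 `^ s < spectral_radius M.
  rewrite -ltr_ln ?posrE ?powR_gt0 ?rt2_gt0 ?(lt_le_trans ltr01) //.
  by rewrite ln_powR -ltr_pdivlMr.
have [z ez rz] := spectral_radius_gt (powR_ge0 _ _) rl.
have [v [V [v0 vV vSe vsup [t vt]]]] := subinvariant_vector ez.
set m := normc z in rz vsup.
have r1 : 1 <= rt2 `^ s.
  by rewrite -[X in X <= _](powRr0 rt2); apply: ler_powR => //; exact: (ltW rt2_gt1).
have m1 : 1 < m := le_lt_trans r1 rz.
have m0 : 0 < m := lt_trans ltr01 m1.
have := Se_sub_Sinf (vSe t vt); rewrite Sinf_types_at.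
move=> /types_at_elem_type[p [w [ps sw tE]]].
pose p0 := refine p w; have u0 : unit_elem p0 by rewrite unit_refine unit_star.
have V0 : 0 <= V := le_trans (v0 t) (vV t).
pose mu := mass m v 19 p0.
have mu0 : 0 < mu by rewrite /mu /mass -tE divr_gt0 ?exprn_gt0.
pose B := 15 * V; have B0 : 0 <= B by rewrite mulr_ge0.
pose A := B * (10 * rt2) `^ s; have A0 : 0 <= A by rewrite mulr_ge0 ?powR_ge0.
(* The weights then contribute at most mu / 2, and the errors [eta] below add up to mu / 4, which
   together stay below mu. *)
pose e := mu / (2 * (A + 1)).
have e0 : 0 < e by rewrite divr_gt0 // mulr_gt0 // ltr_wpDl.
pose delta : R := (1 / 20) / rt2 ^+ 19.
have delta0 : 0 < delta by rewrite divr_gt0 ?exprn_gt0 ?rt2_gt0.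
have : (hausdorff_premeasure euclidean_dist s delta (boundary K) < e%:E)%E.
  apply: (@le_lt_trans _ _ 0%E); last by rewrite lte_fin.
  by rewrite -Hz; apply: ereal_sup_ubound; exists delta.
move=> /ereal_inf_lt[_ [U [cov small] <-] sumU].
pose eta i : R := mu / 4 / (2 ^ i.+1)%:R.
have eta0 i : 0 < eta i by rewrite /eta; apply: divr_gt0; [exact: divr_gt0 | rewrite ltr0n expn_gt0].
have /choice[level hlevel] := fun i =>
  weight_level s0 B0 m1 (ltW rz) (eta0 i) (small i).
have l19 i : (19 <= level i)%N by case: (hlevel i).
have nonneg i : (0 <= A%:E * weight euclidean_dist s (U i))%E.
  by rewrite mule_ge0 // weight_ge0.
apply: (@light_uncovered _ K dK m v m0 v0 vSe vsup U level 19 p0) => //; split=> //.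
apply: (@le_lt_trans _ _ (A * e + mu / 4)%:E); last first.
  rewrite lte_fin -/mu /e.
  have : A * (mu / (2 * (A + 1))) <= mu / 2.
    rewrite mulrCA ler_pM2l // invfM mulrCA ger_pMr //.
    by rewrite ler_pdivrMr ?ltr_wpDl // mul1r lerDl.
  move: mu0; clear; lra.
apply: (@le_trans _ _ (\sum_(0 <= i <oo)
   (A%:E * weight euclidean_dist s (U i) + (eta i)%:E))%E).
  apply: lee_nneseries => [i _ _|i _]; first by rewrite lee_fin hit_mass_ge0.
  have [_ sm wl] := hlevel i.
  have [Ui|Ui] := pselect (U i !=set0).
    apply: le_trans (wl Ui); rewrite lee_fin.
    exact: hit_mass_le.
  have -> : hit_mass m v U level i 19 p0 = 0.
    rewrite /hit_mass; case: ifP => // _; rewrite big1 // => q _.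
    case: (boolP (hit U level i q)) => [/asboolP[x [_ Ux]]|_]; last by rewrite mul0r.
    by case: Ui; exists x.
  by rewrite adde_ge0 // lee_fin ltW.
apply: le_trans (epsilon_trick _ _ _) _ => //; first by rewrite divr_ge0 // ltW.
rewrite EFinD; apply: leeD => //.
rewrite nneseriesZl => [|i _]; last exact: weight_ge0.
rewrite [(A * e)%:E]EFinM; apply: lee_wpmul2l; last exact: ltW.
by rewrite lee_fin.
Qed.

End Lower.

(** * The dimension as the critical exponent *)

Theorem mainTheorem3 (R : realType) (K : set (R * R)) (lambda : R) :
  is_levy_dragon K ->
  lambda = spectral_radius (map_mx (fun n : nat => n%:R : R[i]) child_matrix) ->
  hausdorff_dim euclidean_dist (boundary K)
    = (ln lambda / ln (Num.sqrt 2))%:E.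
Proof.
move=> dK ->; set M := map_mx _ _.
set s0 : R := _ / _.
have s00 : 0 <= s0.
  by rewrite divr_ge0 ?ln_ge0 ?spectral_radius_child_ge1 // ltW // rt2_gt1.
apply/eqP; rewrite eq_le; apply/andP; split; last first.
  apply: le_ereal_inf_tmp => _ [s [s_ge0 Hs] <-]; rewrite lee_fin leNgt.
  by apply/negP => lt; exact: boundary_hausdorff_measure_neq0 dK s_ge0 lt Hs.
apply/lee_addgt0Pr => e e0; rewrite -EFinD.
apply: ereal_inf_lbound; exists (s0 + e) => //; split; first by rewrite addr_ge0 // ltW.
apply: boundary_hausdorff_measure0 => //; first by rewrite addr_ge0 // ltW.
by rewrite ltrDl.
Qed.
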